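(* Let $n\ge 2$ and let $r\in\{-3,-2\}$. There are no irreducible (effective) divisors $D$ on $X_{n,s}$ with $\langle D,D\rangle=r$ and $\operatorname{adeg}(D)=-2-r$.
   Context: We work over $\mathbb{C}$. $X_{n,s}$ denotes the blow up of $\mathbb{P}^n$ at $s$ points $p_1,\dots,p_s$ in general position (i.e. outside a suitable countable union of proper closed subsets of $(\mathbb{P}^n)^s$). $\operatorname{Pic}(X_{n,s})$ is freely generated by $H,E_1,\dots,E_s$, where $H$ is the class of a general hyperplane and $E_j$ is the exceptional divisor over $p_j$. The Dolgachev-Mukai pairing is the symmetric bilinear form with $\langle H,H\rangle=n-1$, $\langle H,E_j\rangle=0$, $\langle E_i,E_j\rangle=-\delta_{i,j}$. With $K_{X_{n,s}}=-(n+1)H+(n-1)\sum_jE_j$, put $\operatorname{adeg}(D)=\frac{1}{n-1}\langle D,-K_{X_{n,s}}\rangle$. Explicitly, for $D=dH-\sum_j m_jE_j$: $\langle D,D\rangle=(n-1)d^2-\sum_j m_j^2$ and $\operatorname{adeg}(D)=(n+1)d-\sum_j m_j$. An irreducible divisor is a nonzero effective divisor with irreducible support (possibly non-reduced). *)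

(* Defs.v *)
From HB Require Import structures.
From mathcomp Require Import all_boot all_order all_algebra.
From mathcomp Require Import reals complex.
From mathcomp Require Import mpoly.

Set Implicit Arguments.
Unset Strict Implicit.
Unset Printing Implicit Defensive.

Import Order.TTheory GRing.Theory Num.Theory.
Local Open Scope ring_scope.

(* The ground field is C = complex R with R a realType, i.e. a complete ordered
   field; algC is countable, so "very general" would be void over it. *)

(* Row j of p is a vector of homogeneous coordinates of the j-th point of P^n. *)
Definition is_config (R : realType) (n s : nat)
    (p : 'M[complex R]_(s, n.+1)) : Prop :=
  forall j : 'I_s, row j p != 0.

(* Homogeneous separately in each of the s groups of n+1 variables; the variable
   of index mxvec_index j i is the i-th coordinate of the j-th point. *)
Definition multihomog (R : realType) (n s : nat)
    (P : {mpoly (complex R)[s * n.+1]}) : Prop :=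
  exists e : 'I_s -> nat, forall m, m \in msupp P ->
    forall j : 'I_s, (\sum_(i < n.+1) m (mxvec_index j i))%N = e j.

Definition zero_locus (R : realType) (n s : nat)
    (S : {mpoly (complex R)[s * n.+1]} -> Prop)
    (p : 'M[complex R]_(s, n.+1)) : Prop :=
  forall P, S P -> P.@[fun k => mxvec p 0 k] = 0.

Definition defines_proper_closed (R : realType) (n s : nat)
    (S : {mpoly (complex R)[s * n.+1]} -> Prop) : Prop :=
  (forall P, S P -> @multihomog R n s P) /\
  (exists p : 'M[complex R]_(s, n.+1), is_config p /\ ~ zero_locus S p).

(* Q holds for all (p_1, ..., p_s) outside some countable union of proper closed
   subsets of (P^n)^s. The diagonals p_i = p_j are proper closed subsets, so they
   may always be included among the excluded loci. *)
Definition for_general_points (R : realType) (n s : nat)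
    (Q : 'M[complex R]_(s, n.+1) -> Prop) : Prop :=
  exists S : nat -> {mpoly (complex R)[s * n.+1]} -> Prop,
    (forall k, defines_proper_closed (S k)) /\
    (forall p, is_config p -> (forall k, ~ zero_locus (S k) p) -> Q p).

(* For n >= 2, every effective divisor on the blow up X_{n,s} is uniquely the
   strict transform of an effective divisor of P^n plus a nonnegative combination
   of the E_j. An effective divisor of P^n is a nonzero form up to a nonzero
   scalar. Hence Divisor F a stands for
   (strict transform of {F = 0}) + \sum_j a_j E_j. *)
Record divisor (R : realType) (n s : nat) := Divisor {
  hyp : {mpoly (complex R)[n.+1]};
  exc : {ffun 'I_s -> nat}
}.

Definition is_form (R : realType) (n : nat)
    (F : {mpoly (complex R)[n.+1]}) : Prop :=
  F != 0 /\ exists d, F \is d.-homog.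

Definition effective (R : realType) (n s : nat) (D : divisor R n s) : Prop :=
  is_form (hyp D).

Definition same_divisor (R : realType) (n s : nat)
    (D D' : divisor R n s) : Prop :=
  (exists2 c : complex R, c != 0 & hyp D = c *: hyp D') /\ exc D = exc D'.

Definition div0 (R : realType) (n s : nat) : divisor R n s :=
  Divisor 1 [ffun => 0%N].

Definition divD (R : realType) (n s : nat)
    (D D' : divisor R n s) : divisor R n s :=
  Divisor (hyp D * hyp D') [ffun j => (exc D j + exc D' j)%N].

Definition divMn (R : realType) (n s : nat)
    (D : divisor R n s) (k : nat) : divisor R n s :=
  Divisor (hyp D ^+ k) [ffun j => (k * exc D j)%N].

Definition prime_divisor (R : realType) (n s : nat)
    (D : divisor R n s) : Prop :=
  [/\ effective D, ~ same_divisor D (div0 R n s) &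
      forall D1 D2, effective D1 -> effective D2 ->
        same_divisor D (divD D1 D2) ->
        same_divisor D1 (div0 R n s) \/ same_divisor D2 (div0 R n s)].

(* Irreducible support means a positive multiple of a prime divisor. *)
Definition irreducible_divisor (R : realType) (n s : nat)
    (D : divisor R n s) : Prop :=
  effective D /\
  exists P k, [/\ prime_divisor P, (0 < k)%N & same_divisor D (divMn P k)].

(* Lowest degree of a monomial of the Taylor expansion F(v + x) (junk if F = 0).
   For a form F this is the multiplicity of {F = 0} at the point [v] of P^n,
   because the affine cone minus the origin is locally a product of P^n with
   a smooth curve. *)
Definition mult (R : realType) (n : nat) (v : 'rV[complex R]_n.+1)
    (F : {mpoly (complex R)[n.+1]}) : nat :=
  let G := F \mPo [tuple 'X_i + (v 0 i)%:MP | i < n.+1] in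
  \big[minn/msize G]_(m <- msupp G) mdeg m.

(* The pull-back (total transform) of {F = 0} under the blow up of the p_j. *)
Definition pullback (R : realType) (n s : nat) (p : 'M[complex R]_(s, n.+1))
    (F : {mpoly (complex R)[n.+1]}) : divisor R n s :=
  Divisor F [ffun j => mult (row j p) F].

(* D - D' is the divisor of the pull-back of the rational function A / B. *)
Definition lin_equiv (R : realType) (n s : nat) (p : 'M[complex R]_(s, n.+1))
    (D D' : divisor R n s) : Prop :=
  exists (A B : {mpoly (complex R)[n.+1]}) (e : nat),
    [/\ A != 0 /\ A \is e.-homog, B != 0 /\ B \is e.-homog &
        same_divisor (divD D (pullback p B)) (divD D' (pullback p A))].

Definition excdiv (R : realType) (n s : nat) (a : 'I_s -> nat) :
    divisor R n s :=
  Divisor 1 [ffun j => a j].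

(* Coordinates of Pic(X_{n,s}) in the basis H, E_1, ..., E_s:
   (d, e) stands for d H + \sum_j e_j E_j, so m_j = - e_j. *)
Definition pic (s : nat) : zmodType := (int * 'rV[int]_s)%type.

(* The class of D is delta. Both sides are moved to effective divisors: with
   delta = (a' - a) H + \sum_j (b'_j - b_j) E_j, the divisors
   D + a H + \sum_j b_j E_j and a' H + \sum_j b'_j E_j are linearly equivalent,
   H being represented by a hyperplane {l = 0} through none of the p_j. *)
Definition has_class (R : realType) (n s : nat) (p : 'M[complex R]_(s, n.+1))
    (D : divisor R n s) (delta : pic s) : Prop :=
  exists (l : {mpoly (complex R)[n.+1]}) (a a' : nat) (b b' : 'I_s -> nat),
    [/\ l != 0 /\ l \is 1.-homog,
        forall j : 'I_s, l.@[fun i => p j i] != 0,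
        delta = (a'%:Z - a%:Z, \row_j ((b' j)%:Z - (b j)%:Z)) &
        lin_equiv p
          (divD D (divD (divMn (pullback p l) a) (excdiv R n b)))
          (divD (divMn (pullback p l) a') (excdiv R n b'))].

Definition DMpairing (n s : nat) (x y : pic s) : int :=
  (n%:Z - 1) * x.1 * y.1 - \sum_(j < s) x.2 0 j * y.2 0 j.

Definition canonical_class (n s : nat) : pic s :=
  (- (n%:Z + 1), \row_(j < s) (n%:Z - 1)).

Definition adeg (n s : nat) (x : pic s) : rat :=
  (DMpairing n x (- canonical_class n s))%:~R / (n%:R - 1).

(* Main.v *)
Require Import Defs.
From HB Require Import structures.
From mathcomp Require Import all_boot all_order all_algebra.
From mathcomp Require Import reals complex.
From mathcomp Require Import mpoly zify ring.

(** The proof is Noether's descent by Cremona maps.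

    An irreducible divisor is a multiple of a prime divisor, so its class is
    [k] times a prime class and [k ^ 2] divides [r]; as 2 and 3 are squarefree,
    the divisor is prime up to a scalar.  The exceptional divisors have
    self-pairing [-1], so the divisor is the strict transform of an irreducible
    form [F] of degree [d > 0] with multiplicities [m_j] satisfying
    [\sum m_j = (n+1) d - a] and [\sum m_j^2 = (n-1) d^2 + rho], where
    [(a, rho)] is [(0, 2)] or [(1, 3)].

    Since [a >= 0], [rho > 0] and [m_j <= d], a Noether inequality
    ([noether_inequality]) shows that, as soon as there are [n+1] points, the
    [n+1] largest multiplicities sum to more than [(n-1) d].  The standard
    Cremona map based at these [n+1] points then turns [F] into an irreducible
    form of smaller degree ([cremona_step]); both numerical relations persist
    for the new form and the new points ([cremona_numerics]).  The form could
    only be destroyed if it were a fundamental hyperplane, but that has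
    self-pairing [-1].  Infinite descent on [d] gives the contradiction
    ([no_irreducible_form]).

    In coordinates where the base points are the coordinate points, the Cremona
    map merely reflects exponents: a monomial [x^m] of degree [d] is sent to
    [x^(d-m)].  The multiplicity of [F] at the [i]-th coordinate point is the
    exponent with which ['X_i] divides the transform of [F]
    ([has_order_crem], [mult_coordinate]); away from the coordinate
    hyperplanes the map is invertible and multiplicities are unchanged
    ([mult_crem]).

    The descent needs the points to stay in linearly general position after any
    sequence of Cremona maps.  Each finite sequence of frames gives one
    polynomial condition on the original points ([word_poly]), and there are
    countably many.  Each condition is a nonzero polynomial because the Cremona
    map is an involution up to projective equivalence ([cremona_configK]).  It
    is multihomogeneous because it is a semi-invariant of the rescalings of the
    points ([semi_invariant_multihomog]). *)

Set Implicit Arguments.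
Unset Strict Implicit.
Unset Printing Implicit Defensive.

Import Order.TTheory GRing.Theory Num.Theory.
Local Open Scope ring_scope.

(** * Orders of polynomials for additive weights *)

Section Order.
Variables (K : idomainType) (n : nat) (mf : measure n).
Implicit Types P Q : {mpoly K[n]}.

(** The weight decides which order is bounded: the total degree gives the order of
    vanishing at the origin, the exponent of one variable the valuation along a
    coordinate hyperplane, and the degree in the other variables the order along
    a coordinate axis. *)
Definition order_ge k P := forall m, m \in msupp P -> (k <= mf m)%N.

Definition has_order P k := order_ge k P /\ exists2 m, m \in msupp P & mf m = k.

Lemma order_ge0 k : order_ge k 0.
Proof. by move=> m; rewrite msupp0. Qed.

Lemma order_geW k l P : (l <= k)%N -> order_ge k P -> order_ge l P.
Proof. by move=> lk h m /h; apply: leq_trans. Qed.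

Lemma order_geD k P Q : order_ge k P -> order_ge k Q -> order_ge k (P + Q).
Proof. by move=> hP hQ m /msuppD_le; rewrite mem_cat => /orP[/hP|/hQ]. Qed.

Lemma order_geZ k c P : order_ge k P -> order_ge k (c *: P).
Proof. by move=> hP m /msuppZ_le /hP. Qed.

Lemma order_ge_sum (I : eqType) (r : seq I) (F : I -> {mpoly K[n]}) k :
  {in r, forall i, order_ge k (F i)} -> order_ge k (\sum_(i <- r) F i).
Proof.
move=> h; rewrite big_seq; apply: big_ind => //; first exact: order_ge0.
by move=> *; apply: order_geD.
Qed.

Lemma order_geM k l P Q : order_ge k P -> order_ge l Q -> order_ge (k + l) (P * Q).
Proof.
move=> hP hQ m /msuppM_le /allpairsP[[a b] /= [/hP ha /hQ hb ->]].
by rewrite mfD leq_add.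
Qed.

Lemma order_ge_exp k P e : order_ge k P -> order_ge (e * k) (P ^+ e).
Proof.
move=> h; elim: e => [|e IH]; first by rewrite mul0n.
by rewrite exprS mulSn; apply: order_geM.
Qed.

Lemma order_ge_prod (I : Type) (r : seq I) (F : I -> {mpoly K[n]}) (w : I -> nat) :
  (forall i, order_ge (w i) (F i)) ->
  order_ge (\sum_(i <- r) w i) (\prod_(i <- r) F i).
Proof.
move=> h; elim: r => [|i r IH]; first by rewrite !big_nil.
by rewrite !big_cons; apply: order_geM.
Qed.

Lemma has_order_neq0 P k : has_order P k -> P != 0.
Proof. by case=> _ [m + _]; apply: contraTneq => ->; rewrite msupp0. Qed.

Lemma has_order_ex P : P != 0 -> exists k, has_order P k.
Proof.
rewrite -msupp_eq0 => /eqP P0.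
have ex : exists k, has (fun m => mf m == k) (msupp P).
  by case: (msupp P) P0 => // m s _; exists (mf m); rewrite /= eqxx.
case: (ex_minnP ex) => k /hasP[m mP /eqP mk] kmin; exists k.
split; last by exists m.
by move=> m' m'P; apply: kmin; apply/hasP; exists m'.
Qed.

Lemma order_ge_le P k l : has_order P k -> order_ge l P -> (l <= k)%N.
Proof. by case=> _ [m mP <-]; apply. Qed.

Lemma has_order_uniq P k l : has_order P k -> has_order P l -> k = l.
Proof.
move=> hk hl; apply/eqP; rewrite eqn_leq (order_ge_le hl hk.1).
by rewrite (order_ge_le hk hl.1).
Qed.

Lemma mcoeff_pihomog k P m :
  (pihomog mf k P)@_m = if mf m == k then P@_m else 0.
Proof.
rewrite pihomogE raddf_sum /=.
under eq_bigr => i _ do rewrite mcoeffZ mcoeffX.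
case: (boolP (m \in msupp P)) => [mP|/[dup] mP /memN_msupp_eq0 ->].
  rewrite (bigID (pred1 m)) /= [X in _ + X]big1 ?addr0; last first.
    by move=> i /andP[_ /negPf ->]; rewrite mulr0.
  rewrite -big_filter.
  have -> : [seq i <- msupp P | (mf i == k) && (i == m)] =
            [seq i <- [:: m] | mf i == k].
    rewrite -(filter_pred1_uniq (msupp_uniq P) mP) -filter_predI.
    by apply: eq_filter => i /=.
  by rewrite big_filter big_mkcond big_seq1 eqxx mulr1.
rewrite if_same big_seq_cond big1 // => i /andP[iP _].
by rewrite eq_sym (negPf (memPnC mP _ iP)) mulr0.
Qed.

(** The parts of lowest weight of the two factors multiply to a nonzero polynomial,
    and everything else in the product has larger weight. *)
Lemma has_orderM P Q k l :
  has_order P k -> has_order Q l -> has_order (P * Q) (k + l).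
Proof.
move=> hP hQ; split; first exact: order_geM hP.1 hQ.1.
have part R r : has_order R r ->
    pihomog mf r R != 0 /\ order_ge r.+1 (R - pihomog mf r R).
  move=> [ge [m mR mr]]; split.
    apply/eqP => /(congr1 (mcoeff m)) /eqP.
    by rewrite mcoeff_pihomog mr eqxx mcoeff0 mcoeff_eq0 mR.
  move=> i; rewrite mcoeff_msupp mcoeffB mcoeff_pihomog.
  case: (mf i =P r) => [_|ir]; first by rewrite subrr eqxx.
  rewrite subr0 -mcoeff_msupp => /ge; rewrite leq_eqVlt => /orP[/eqP|//].
  by move/esym.
have [A0 hA] := part _ _ hP; have [B0 hB] := part _ _ hQ.
set A := pihomog mf k P in A0 hA; set B := pihomog mf l Q in B0 hB.
have AP : order_ge k A by move=> m /(dhomog_mf (pihomogP _ _ _)) ->.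
have : A * B != 0 by rewrite mulf_neq0.
rewrite -msupp_eq0; case E : (msupp _) => [//|m s] _.
have mAB : m \in msupp (A * B) by rewrite E inE eqxx.
have mkl : mf m = (k + l)%N.
  by apply: (dhomog_mf (dhomogM (pihomogP _ _ _) (pihomogP _ _ _))) mAB.
exists m => //.
have PQ : P * Q = A * B + (A * (Q - B) + (P - A) * Q).
  by rewrite mulrBr mulrBl addrA [A * B + _]addrC subrK addrC subrK.
rewrite mcoeff_msupp PQ mcoeffD [X in _ + X]memN_msupp_eq0.
  by rewrite addr0 -mcoeff_msupp.
have : order_ge (k + l).+1 (A * (Q - B) + (P - A) * Q).
  apply: order_geD; first by rewrite -addnS; apply: order_geM.
  by rewrite -addSn; apply: order_geM => //; case: hQ.
by move=> h; apply/negP => /h; rewrite mkl ltnn.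
Qed.

End Order.

(** * Substitutions *)

(** Substituting a function of the index instead of a tuple makes composition and
    extensionality of substitutions pointwise. *)
Notation psub T P := (comp_mpoly (mktuple T) P).

Definition degin n (a : pred 'I_n) (m : 'X_{1..n}) := (\sum_(i | a i) m i)%N.

Lemma degin0 n a : @degin n a 0%MM = 0%N.
Proof. by apply: big1 => i _; rewrite mnm0E. Qed.

Lemma deginD n a : {morph @degin n a : m1 m2 / (m1 + m2)%MM >-> (m1 + m2)%N}.
Proof. by move=> m p; rewrite -big_split; apply: eq_bigr => i _; rewrite mnmDE. Qed.

HB.instance Definition _ n a := isMeasure.Build n (@degin n a) (degin0 a) (deginD a).

Lemma degin1 n i (m : 'X_{1..n}) : degin (pred1 i) m = m i.
Proof. by rewrite /degin big_pred1_eq. Qed.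

Lemma deginC1 n i (m : 'X_{1..n}) : degin (predC1 i) m = (mdeg m - m i)%N.
Proof. by rewrite mdegE (bigD1 i) //= addKn. Qed.

Lemma deginU n a (i : 'I_n) : degin a U_(i)%MM = a i.
Proof.
rewrite /degin big_mkcond (bigD1 i) //= mnm1E eqxx big1 ?addn0; first by case: (a i).
by move=> j ji; rewrite mnm1E eq_sym (negPf ji) if_same.
Qed.

Section Substitution.
Variable K : idomainType.

Lemma psubE n k (T : 'I_n -> {mpoly K[k]}) P :
  psub T P = \sum_(m <- msupp P) P@_m *: \prod_i T i ^+ m i.
Proof.
rewrite comp_mpolyE; apply: eq_bigr => m _; congr (_ *: _).
by apply: eq_bigr => i _; rewrite tnth_mktuple.
Qed.

Lemma psubXm n k (T : 'I_n -> {mpoly K[k]}) m :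
  psub T 'X_[m] = \prod_i T i ^+ m i.
Proof. by rewrite comp_mpolyX; apply: eq_bigr => i _; rewrite tnth_mktuple. Qed.

Lemma psubX n k (T : 'I_n -> {mpoly K[k]}) i : psub T 'X_i = T i.
Proof. by rewrite comp_mpolyXU -tnth_nth tnth_mktuple. Qed.

Lemma psub_eq n k (T S : 'I_n -> {mpoly K[k]}) P :
  T =1 S -> psub T P = psub S P.
Proof.
move=> TS; rewrite !psubE; apply: eq_bigr => m _; congr (_ *: _).
by apply: eq_bigr => i _; rewrite TS.
Qed.

Lemma psub_id n (P : {mpoly K[n]}) : psub (fun i => 'X_i) P = P.
Proof. exact: comp_mpoly_id. Qed.

Lemma psub_psub n k l (T : 'I_n -> {mpoly K[k]}) (S : 'I_k -> {mpoly K[l]}) P :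
  psub S (psub T P) = psub (fun i => psub S (T i)) P.
Proof.
rewrite (psubE T) [RHS]psubE raddf_sum /=; apply: eq_bigr => m _.
rewrite comp_mpolyZ rmorph_prod; congr (_ *: _).
by apply: eq_bigr => i _; rewrite rmorphXn.
Qed.

Lemma meval_psub n k (T : 'I_n -> {mpoly K[k]}) v P :
  (psub T P).@[v] = P.@[fun i => (T i).@[v]].
Proof.
by rewrite comp_mpoly_meval; apply: meval_eq => i; rewrite tnth_mktuple.
Qed.

Lemma prod_scale n k (M : {mpoly K[k]}) (T : 'I_n -> {mpoly K[k]}) (m : 'X_{1..n}) :
  \prod_i (M * T i) ^+ m i = M ^+ mdeg m * \prod_i T i ^+ m i.
Proof.
under eq_bigr do rewrite exprMn.
by rewrite big_split /= mdegE -expr_sum.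
Qed.

Lemma psub_scale n k d M (T : 'I_n -> {mpoly K[k]}) P : P \is d.-homog ->
  psub (fun i => M * T i) P = M ^+ d * psub T P.
Proof.
move=> hP; rewrite !psubE mulr_sumr; apply: eq_big_seq => m mP.
by rewrite prod_scale (dhomog_mf hP mP) scalerAr.
Qed.

(** Comparing weights on the variables suffices. This one principle gives all the
    lower bounds on multiplicities below. *)
Lemma order_ge_psub n k (mf : measure n) (mf' : measure k) r
    (T : 'I_n -> {mpoly K[k]}) P :
  (forall i, order_ge mf' (mf U_(i)%MM) (T i)) -> order_ge mf r P ->
  order_ge mf' r (psub T P).
Proof.
move=> hT hP; rewrite psubE; apply: order_ge_sum => m mP; apply: order_geZ.
apply: order_geW (hP _ mP) _; rewrite mfE.
by apply: order_ge_prod => i; apply: order_ge_exp.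
Qed.

Lemma dhomog_psub n k (mf : measure k) (t : 'I_n -> nat) d
    (T : 'I_n -> {mpoly K[k]}) P :
  (forall i, T i \is (t i).-homog for mf) ->
  {in msupp P, forall m : 'X_{1..n}, (\sum_i m i * t i)%N = d} ->
  psub T P \is d.-homog for mf.
Proof.
move=> hT hP; rewrite psubE big_seq; apply: rpred_sum => m mP; apply: rpredZ.
rewrite -(hP _ mP); elim: (index_enum _) => [|i s IH].
  by rewrite !big_nil dhomog1.
by rewrite !big_cons; apply: dhomogM => //; rewrite mulnC; apply: dhomogMn.
Qed.

Lemma dhomog_psub_deg n k t d (T : 'I_n -> {mpoly K[k]}) P :
  (forall i, T i \is t.-homog) -> P \is d.-homog ->
  psub T P \is (d * t).-homog.
Proof.
move=> hT hP; apply: (dhomog_psub (t := fun=> t)) => // m mP.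
by rewrite -big_distrl /= -mdegE (dhomog_mf hP mP).
Qed.

Lemma psub_mono n k (T : 'I_n -> {mpoly K[k]}) (h : 'X_{1..n} -> 'X_{1..k}) P :
  {in msupp P, forall m, psub T 'X_[m] = 'X_[h m]} ->
  psub T P = \sum_(m <- msupp P) P@_m *: 'X_[h m].
Proof.
move=> hT; rewrite comp_mpolyEX; apply: eq_big_seq => m mP; congr (_ *: _).
exact: hT.
Qed.

(** A substitution by monomials that keeps the monomials of [P] distinct creates no
    cancellation, so orders can be read off before the substitution. *)
Lemma msupp_psub_mono n k (T : 'I_n -> {mpoly K[k]})
    (h : 'X_{1..n} -> 'X_{1..k}) P :
  {in msupp P, forall m, psub T 'X_[m] = 'X_[h m]} ->
  {in msupp P &, injective h} ->
  perm_eq (msupp (psub T P)) (map h (msupp P)).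
Proof.
move=> hT hinj; rewrite (psub_mono hT).
set s := map h _; have us : uniq s by rewrite map_inj_in_uniq ?msupp_uniq.
(* For [m'] in the image of [h] the sum has a single term. *)
pose c m' := (\sum_(m <- msupp P | h m == m') P@_m).
have ch m : m \in msupp P -> c (h m) = P@_m.
  move=> mP; rewrite /c (big_rem m) //= eqxx big_seq_cond big1 ?addr0 //.
  move=> i /andP[]; rewrite mem_rem_uniq ?msupp_uniq // inE => /andP[im iP].
  by move/eqP/(hinj _ _ iP mP)/eqP; rewrite (negPf im).
have eqs : \sum_(m <- msupp P) P@_m *: 'X_[h m] = \sum_(m <- s) c m *: 'X_[K, m].
  by rewrite [RHS]big_map; apply: eq_big_seq => m mP; rewrite ch.
rewrite eqs; apply: msupp_sumX => // m' /mapP[m mP ->].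
by rewrite ch // -mcoeff_msupp.
Qed.

Lemma has_order_psub_mono n k (mf : measure n) (mf' : measure k)
    (T : 'I_n -> {mpoly K[k]}) (h : 'X_{1..n} -> 'X_{1..k}) P r :
  {in msupp P, forall m, psub T 'X_[m] = 'X_[h m]} ->
  {in msupp P &, injective h} ->
  {in msupp P, forall m, mf' (h m) = mf m} ->
  has_order mf P r -> has_order mf' (psub T P) r.
Proof.
move=> hT hinj hmf [ge [m mP mr]].
have memP := perm_mem (msupp_psub_mono hT hinj).
split; first by move=> m'; rewrite memP => /mapP[m1 m1P ->]; rewrite hmf ?ge.
by exists (h m); rewrite ?memP ?map_f ?hmf.
Qed.

End Substitution.

(** * Forms up to monomial factors *)

Definition irreducible_form (K : idomainType) N d (F : {mpoly K[N]}) :=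
  [/\ F != 0, F \is d.-homog, (0 < d)%N &
      forall e1 e2 A B, A \is e1.-homog -> B \is e2.-homog -> F = A * B ->
        e1 = 0%N \/ e2 = 0%N].

Section Reduced.
Variables (K : idomainType) (N : nat).
Implicit Types P Q F G : {mpoly K[N]}.

(** The form contains none of the coordinate hyperplanes. *)
Definition reduced P := forall i, has_order (degin (pred1 i)) P 0.

Lemma has_orderX (mf : measure N) m : has_order mf ('X_[m] : {mpoly K[N]}) (mf m).
Proof.
by split=> [p|]; [|exists m => //]; rewrite msuppX mem_seq1 // => /eqP ->.
Qed.

Lemma mpolyX_neq0 m : 'X_[m] != 0 :> {mpoly K[N]}.
Proof. by rewrite -msupp_eq0 msuppX. Qed.

Lemma monomial_divides (a : 'X_{1..N}) P :
  (forall i, order_ge (degin (pred1 i)) (a i) P) -> exists Q, P = 'X_[a] * Q.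
Proof.
move=> h; exists (\sum_(m <- msupp P) P@_m *: 'X_[m - a]).
rewrite {1}[P]mpolyE mulr_sumr; apply: eq_big_seq => m mP.
rewrite -scalerAr -mpolyXD; congr (_ *: 'X_[_]); rewrite addmC submK //.
by apply/mnm_lepP => i; have := h i _ mP; rewrite /= degin1.
Qed.

Lemma reduced_part P : P != 0 ->
  exists (a : 'X_{1..N}) Q, [/\ P = 'X_[a] * Q, reduced Q &
    forall i, has_order (degin (pred1 i)) P (a i)].
Proof.
move=> P0; have ex i := has_order_ex (degin (pred1 i)) P0.
have [c cP] := fin_all_exists ex.
pose a := [multinom c i | i < N].
have aP i : has_order (degin (pred1 i)) P (a i) by rewrite mnmE.
have [Q PQ] := monomial_divides (fun i => (aP i).1).
exists a, Q; split=> // i.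
have Q0 : Q != 0 by apply: contraNneq P0 => Q0; rewrite PQ Q0 mulr0.
have [k Qk] := has_order_ex (degin (pred1 i)) Q0.
have := has_orderM (has_orderX (degin (pred1 i)) a) Qk.
rewrite -PQ /= degin1 => /(has_order_uniq (aP i)) /eqP.
by rewrite -{1}[a i]addn0 eqn_add2l => /eqP k0; rewrite k0.
Qed.

(** The exponents are the valuations along the coordinate hyperplanes. *)
Lemma reduced_uniq (a b : 'X_{1..N}) P Q :
  reduced P -> reduced Q -> 'X_[a] * P = 'X_[b] * Q -> a = b /\ P = Q.
Proof.
move=> rP rQ E; have ab : a = b.
  apply/mnmP => i; pose mf := degin (pred1 i) : measure N.
  have := has_orderM (has_orderX mf a) (rP i); rewrite E.
  move/(has_order_uniq (has_orderM (has_orderX mf b) (rQ i))).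
  by rewrite /= !degin1 !addn0.
by split=> //; apply: (mulfI (mpolyX_neq0 b)); rewrite -E ab.
Qed.

Lemma reducedM P Q : reduced P -> reduced Q -> reduced (P * Q).
Proof. by move=> rP rQ i; have := has_orderM (rP i) (rQ i). Qed.

Lemma reducedC (c : K) : c != 0 -> reduced (c%:MP : {mpoly K[N]}).
Proof.
move=> c0 i; split=> //; exists 0%MM; last exact: mf0.
by rewrite msuppC (negPf c0) inE.
Qed.

Lemma reduced_factor P Q : P * Q != 0 -> reduced (P * Q) -> reduced P.
Proof.
rewrite mulf_eq0 negb_or => /andP[P0 Q0] r i.
have [k hk] := has_order_ex (degin (pred1 i)) P0.
have [l hl] := has_order_ex (degin (pred1 i)) Q0.
have /eqP := has_order_uniq (r i) (has_orderM hk hl).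
by rewrite eq_sym addn_eq0 => /andP[/eqP k0 _]; rewrite k0 in hk.
Qed.

Lemma dhomog_mulXK (a : 'X_{1..N}) P d :
  'X_[a] * P \is d.-homog -> P \is (d - mdeg a).-homog.
Proof.
move=> /dhomogP h; apply/dhomogP => m mP.
have := h (a + m)%MM; rewrite mulrC (perm_mem (msuppMX _ _)) map_f //.
by move=> /(_ isT); rewrite /= mdegD => <-; rewrite addKn.
Qed.

Lemma dhomog0_const P : P \is 0.-homog -> exists c, P = c%:MP.
Proof.
move=> h; exists P@_0; apply/mpolyP => m; rewrite mcoeffC.
have [->|m0] := eqVneq m 0%MM; first by rewrite mulr1.
rewrite mulr0; apply: dhomog_nemf_coeff h _.
by rewrite mdeg_eq0.
Qed.

Lemma const_dhomog (c : K) d : c != 0 ->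
  (c%:MP : {mpoly K[N]}) \is d.-homog -> d = 0%N.
Proof.
move=> c0 h; apply: (dhomog_uniq _ h); first by rewrite mpolyC_eq0.
by apply/dhomogP => m; rewrite msuppC (negPf c0) inE => /eqP ->; exact: mdeg0.
Qed.

Lemma reduced_or_linear d F : irreducible_form d F ->
  reduced F \/ exists i (c : K), d = 1%N /\ F = c *: 'X_i.
Proof.
move=> [F0 hF dgt irr].
case: (reduced_part F0) => a [Q [E rQ ha]].
have [a0|/eqP] := eqVneq a 0%MM.
  by left; rewrite E a0 mpolyX0 mul1r.
case: (pickP (fun i => 0 < a i)%N) => [i ai _|a0]; last first.
  by case; apply/mnmP => i; rewrite mnm0E; have := a0 i; case: (a i).
right; exists i.
have [G FG] : exists G, F = 'X_i * G.
  apply: monomial_divides => j m mF.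
  have := (ha j).1 _ mF; rewrite mnm1E; case: eqP => [<-|//].
  by apply: leq_trans.
have hG : G \is (d - 1).-homog.
  by have := hF; rewrite FG => /dhomog_mulXK; rewrite mdeg1.
have hX : ('X_i : {mpoly K[N]}) \is 1.-homog by rewrite dhomogX /= mdeg1.
case: (irr _ _ _ _ hX hG FG) => // d1.
have [c Gc] : exists c, G = c%:MP by apply: dhomog0_const; rewrite d1 in hG.
by exists c; split; [move: dgt d1; clear; lia | rewrite FG Gc mulrC mul_mpolyC].
Qed.

End Reduced.

(** * The standard Cremona map on forms *)

Section Cremona.
Variables (K : idomainType) (N : nat).
Hypothesis N2 : (2 <= N)%N.
Implicit Types P Q F G : {mpoly K[N]}.

(** The exponents of a monomial after substituting for each variable the product of
    all the others; on monomials of degree [d] this is the reflection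
    [m |-> d - m]. *)
Definition crem_mnm (m : 'X_{1..N}) := [multinom (mdeg m - m i)%N | i < N].
Definition crem (i : 'I_N) : {mpoly K[N]} := 'X_[crem_mnm U_(i)].

Lemma crem_mnmE m i : crem_mnm m i = degin (predC1 i) m.
Proof. by rewrite mnmE deginC1. Qed.

Lemma crem_mnmD a b : crem_mnm (a + b)%MM = (crem_mnm a + crem_mnm b)%MM.
Proof. by apply/mnmP => i; rewrite mnmDE !crem_mnmE mfD. Qed.

Lemma crem_mnm0 : crem_mnm 0%MM = 0%MM.
Proof. by apply/mnmP => i; rewrite crem_mnmE mf0 mnm0E. Qed.

Lemma crem_mnmMn m e : crem_mnm (m *+ e)%MM = (crem_mnm m *+ e)%MM.
Proof.
by elim: e => [|e IH]; rewrite ?mulm0n ?crem_mnm0 // !mulmS crem_mnmD IH.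
Qed.

Lemma psub_crem_mono m : psub crem 'X_[m] = 'X_[crem_mnm m].
Proof.
rewrite psubXm [in RHS](multinomUE_id m) (big_morph crem_mnm crem_mnmD crem_mnm0).
rewrite -mprodXE; apply: eq_bigr => i _.
by rewrite /crem mpolyXn crem_mnmMn.
Qed.

Lemma mdeg_crem_mnm m : mdeg (crem_mnm m) = (mdeg m * N.-1)%N.
Proof.
have E : (mdeg (crem_mnm m) + mdeg m = N * mdeg m)%N.
  have -> : (N * mdeg m = \sum_(i < N) mdeg m)%N by rewrite sum_nat_const card_ord.
  rewrite mdegE [X in (_ + X)%N]mdegE -big_split /=.
  apply: eq_bigr => i _; rewrite mnmE subnK // mdegE (bigD1 i) //=.
  exact: leq_addr.
move: (mdeg (crem_mnm m)) (mdeg m) E => x y.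
by case: (N) N2 => // k _; rewrite mulSn /= mulnC; lia.
Qed.

(** Reflecting twice is the identity up to the common factor by which the Cremona
    map, written with polynomials, fails to be an involution. *)
Lemma crem_mnmK m : crem_mnm (crem_mnm m) = (m + [multinom (mdeg m * N.-2)%N | i < N])%MM.
Proof.
apply/mnmP => i; rewrite mnmDE [in LHS]mnmE mdeg_crem_mnm !mnmE.
have : (m i <= mdeg m)%N by rewrite mdegE (bigD1 i) //= leq_addr.
move: (m i) (mdeg m) => x y.
by case: (N) N2 => [|[|k]] //= _; rewrite !mulnS; lia.
Qed.

Lemma crem_mnm_inj d : {in [pred m | mdeg m == d] &, injective crem_mnm}.
Proof.
move=> a b; rewrite !inE => /eqP ad /eqP bd /(congr1 crem_mnm).
by rewrite !crem_mnmK ad bd => /addIm.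
Qed.

Lemma psub_cremK d F : F \is d.-homog ->
  psub crem (psub crem F) = 'X_[[multinom (d * N.-2)%N | i < N]] * F.
Proof.
move=> hF; rewrite [in RHS](mpolyE F) mulr_sumr.
rewrite [psub crem F](psub_mono (h := crem_mnm)); last first.
  by move=> m _; apply: psub_crem_mono.
rewrite raddf_sum /=; apply: eq_big_seq => m mF.
rewrite comp_mpolyZ -scalerAr psub_crem_mono.
have /= dm := dhomog_mf hF mF.
by rewrite crem_mnmK addmC mpolyXD dm.
Qed.

Lemma psub_crem_neq0 d F : F \is d.-homog -> F != 0 -> psub crem F != 0.
Proof.
move=> hF F0; apply: contraTneq isT => E; have := psub_cremK hF.
move/eqP; rewrite E raddf0 eq_sym mulf_eq0 (negPf F0) orbF.
by rewrite (negPf (mpolyX_neq0 _ _)).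
Qed.

(** A monomial with exponent [e] in ['X_i] acquires exponent [d - e]: the degree of
    [F] in the variables other than ['X_i] becomes the exponent of ['X_i]. *)
Lemma has_order_crem d F i k : F \is d.-homog ->
  has_order (degin (predC1 i)) F k -> has_order (degin (pred1 i)) (psub crem F) k.
Proof.
move=> hF; apply: (has_order_psub_mono (h := crem_mnm)) => [m _||m _].
- exact: psub_crem_mono.
- by apply: sub_in2 (@crem_mnm_inj d) => m /(dhomog_mf hF) /= <-; rewrite inE.
- by rewrite /= degin1 crem_mnmE.
Qed.

Lemma dhomog_crem d F : F \is d.-homog -> psub crem F \is (d * N.-1).-homog.
Proof.
apply: dhomog_psub_deg => i; rewrite dhomogX /= mdeg_crem_mnm mdeg1 mul1n.
by [].
Qed.

Lemma has_order_crem_inv d F i k : F \is d.-homog -> F != 0 ->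
  has_order (degin (pred1 i)) (psub crem F) k -> has_order (degin (predC1 i)) F k.
Proof.
move=> hF F0 hk; have [l hl] := has_order_ex (degin (predC1 i)) F0.
by rewrite (has_order_uniq hk (has_order_crem hF hl)).
Qed.

(** The transform [G] is what remains of the substituted form after removing the
    coordinate hyperplanes. The situation is symmetric in [F] and [G]: applying
    the map twice multiplies [F] by a monomial, and uniqueness of the monomial
    part then gives both the return formula and the relation between the
    exponents [a] and [b], which are the multiplicities at the coordinate points. *)
Lemma crem_form d F : F \is d.-homog -> F != 0 -> reduced F ->
  exists (a b : 'X_{1..N}) G e,
  [/\ [/\ G != 0, G \is e.-homog, reduced G & (e + mdeg a = d * N.-1)%N],
      psub crem F = 'X_[a] * G, psub crem G = 'X_[b] * F,
      (forall i, (b i + (mdeg a - a i) = d * N.-2)%N) &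
      (forall i, has_order (degin (predC1 i)) F (a i)) /\
      (forall i, has_order (degin (predC1 i)) G (b i))].
Proof.
move=> hF F0 rF; have hcF := dhomog_crem hF.
have cF0 := psub_crem_neq0 hF F0.
have [a [G [E rG ha]]] := reduced_part cF0.
have G0 : G != 0 by apply: contraNneq cF0 => G0; rewrite E G0 mulr0.
have hG : G \is (d * N.-1 - mdeg a).-homog by apply: dhomog_mulXK; rewrite -E.
have adeg_le : (mdeg a <= d * N.-1)%N.
  move: cF0; rewrite -msupp_eq0; case M : (msupp _) => [//|m s] _.
  have mcF : m \in msupp (psub crem F) by rewrite M inE eqxx.
  rewrite -(dhomog_mf hcF mcF) /= !mdegE; apply: leq_sum => i _.
  by have := (ha i).1 _ mcF; rewrite /= degin1.
have [b [F' [E' rF' hb]]] := reduced_part (psub_crem_neq0 hG G0).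
have := psub_cremK hF; rewrite E rmorphM /= psub_crem_mono E' mulrA -mpolyXD.
move=> /(reduced_uniq rF' rF) [ab EF]; subst F'.
exists a, b, G, (d * N.-1 - mdeg a)%N; split=> //.
- by split=> //; rewrite subnK.
- move=> i; have := congr1 (fun m : 'X_{1..N} => m i) ab.
  by rewrite mnmDE !mnmE addnC.
- by split=> i; apply: has_order_crem_inv; eauto.
Qed.

(** A factorisation of [G] transforms back into one of [F], so one of its factors
    becomes a monomial after substitution. Substituting once more, that factor is
    itself a monomial, hence a constant because [G] is reduced. *)
Lemma irreducible_crem d F e G (a b : 'X_{1..N}) : irreducible_form d F -> reduced F ->
  G != 0 -> G \is e.-homog -> reduced G ->
  psub crem F = 'X_[a] * G -> psub crem G = 'X_[b] * F ->
  irreducible_form e G.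
Proof.
move=> [F0 hF dgt irr] rF G0 hG rG EF EG.
have aux e1 A c m : A \is e1.-homog -> reduced A -> A != 0 ->
    psub crem A = 'X_[m] * c%:MP -> e1 = 0%N.
  move=> hA rA A0 EA; have := psub_cremK hA.
  rewrite EA rmorphM /= psub_crem_mono comp_mpolyC => E.
  have c0 : c != 0.
    apply: contraTneq (psub_crem_neq0 hA A0) => c0.
    by rewrite EA c0 mpolyC0 mulr0 eqxx.
  have [_ Ac] := reduced_uniq (reducedC c0) rA E.
  by apply: (@const_dhomog _ N _ _ c0); rewrite Ac.
have fact e1 e2 A B : A \is e1.-homog -> B \is e2.-homog -> G = A * B ->
    e1 = 0%N \/ e2 = 0%N.
  move=> hA hB GAB.
  have := G0; rewrite GAB mulf_eq0 negb_or => /andP[A0 B0].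
  have rA : reduced A by apply: (@reduced_factor _ _ _ B); rewrite -GAB.
  have rB : reduced B by apply: (@reduced_factor _ _ _ A); rewrite mulrC -GAB.
  have [a1 [A' [EA rA' _]]] := reduced_part (psub_crem_neq0 hA A0).
  have [b1 [B' [EB rB' _]]] := reduced_part (psub_crem_neq0 hB B0).
  have := EG; rewrite GAB rmorphM /= EA EB mulrACA -mpolyXD.
  move=> /(reduced_uniq (reducedM rA' rB') rF) [_ FAB].
  have hA' : A' \is (e1 * N.-1 - mdeg a1).-homog.
    by apply: dhomog_mulXK; rewrite -EA; apply: dhomog_crem.
  have hB' : B' \is (e2 * N.-1 - mdeg b1).-homog.
    by apply: dhomog_mulXK; rewrite -EB; apply: dhomog_crem.
  case: (irr _ _ _ _ hA' hB' (esym FAB)) => z; [left|right].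
    move: hA'; rewrite z => /dhomog0_const[c Ac].
    by apply: (aux _ _ c a1 hA rA A0); rewrite EA Ac.
  move: hB'; rewrite z => /dhomog0_const[c Bc].
  by apply: (aux _ _ c b1 hB rB B0); rewrite EB Bc.
split=> //; case: (posnP e) => // e0; exfalso.
move: hG; rewrite e0 => /dhomog0_const[c Gc].
have [F1|] := eqVneq d 0%N; first by rewrite F1 in dgt.
move: EG; rewrite Gc comp_mpolyC -[LHS]mul1r -mpolyX0.
have c0 : c != 0 by apply: contraNneq G0 => c0; rewrite Gc c0 mpolyC0.
move=> /(reduced_uniq (reducedC c0) rF) [_ Fc] /eqP; case.
by apply: (@const_dhomog _ N _ _ c0); rewrite Fc.
Qed.

End Cremona.

(** * Multiplicity at a point *)

Section Degree.
Variables (K : idomainType).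

Definition degree_le n d (P : {mpoly K[n]}) :=
  forall m, m \in msupp P -> (mdeg m <= d)%N.

Lemma degree_leM n d e (P Q : {mpoly K[n]}) :
  degree_le d P -> degree_le e Q -> degree_le (d + e) (P * Q).
Proof.
move=> hP hQ m /msuppM_le /allpairsP[[a b] /= [/hP ha /hQ hb ->]].
by rewrite mdegD leq_add.
Qed.

Lemma degree_le_psub n k d (T : 'I_n -> {mpoly K[k]}) (P : {mpoly K[n]}) :
  (forall i, degree_le 1 (T i)) -> degree_le d P -> degree_le d (psub T P).
Proof.
move=> hT hP; rewrite psubE big_seq.
apply: big_ind => [m|A B hA hB m|m mP]; first by rewrite msupp0.
  by move/msuppD_le; rewrite mem_cat => /orP[/hA|/hB].
suff h : degree_le (mdeg m) (\prod_i T i ^+ m i).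
  by move=> m' /msuppZ_le /h /leq_trans; apply; apply: hP.
rewrite mdegE.
elim: (index_enum _) => [|i s IH].
  by rewrite !big_nil => m'; rewrite msupp1 inE => /eqP ->; rewrite mdeg0.
rewrite !big_cons; apply: degree_leM => //.
elim: (m i) => [|e IHe]; last by rewrite exprS -add1n; apply: degree_leM.
by move=> m'; rewrite expr0 msupp1 inE => /eqP ->; rewrite mdeg0.
Qed.

Lemma mcoeff0_meval n (P : {mpoly K[n]}) : P@_0 = P.@[fun=> 0].
Proof.
rewrite [P in RHS]mpolyE [in LHS](mpolyE P) !raddf_sum /=.
apply: eq_bigr => m _; rewrite mcoeffZ mevalZ mevalX mcoeffX; congr (_ * _).
have [->|] := eqVneq m 0%MM; first by rewrite big1 // => i _; rewrite mnm0E.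
rewrite -mdeg_eq0 mdegE sum_nat_eq0 negb_forall => /existsP[i mi].
by rewrite (bigD1 i) //= expr0n; case: (m i) mi => // e _; rewrite mul0r.
Qed.

Lemma order_ge1 n (P : {mpoly K[n]}) : P.@[fun=> 0] = 0 -> order_ge mdeg 1 P.
Proof.
rewrite -mcoeff0_meval => P0 m mP; rewrite lt0n /= mdeg_eq0.
by apply: contraTneq mP => ->; rewrite mcoeff_msupp P0 eqxx.
Qed.

End Degree.

Lemma has_orderZ (K : idomainType) n (mf : measure n) c (P : {mpoly K[n]}) k :
  c != 0 -> has_order mf P k -> has_order mf (c *: P) k.
Proof.
move=> c0 [ge [m mP mk]]; split; first exact: order_geZ.
by exists m; rewrite ?(perm_mem (msuppZ _ c0)).
Qed.

Lemma bigmin_has_order (K : idomainType) n (P : {mpoly K[n]}) k :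
  has_order mdeg P k -> \big[minn/msize P]_(m <- msupp P) mdeg m = k.
Proof.
move=> [ge [m mP mk]].
have le_size : (k <= msize P)%N by rewrite -mk ltnW // msize_mdeg_lt.
apply/eqP; rewrite eqn_leq; apply/andP; split.
  rewrite -[X in (_ <= X)%N]mk; elim: (msupp P) mP => // p s IH.
  rewrite big_cons inE geq_min => /orP[/eqP <-|/IH ->]; first by rewrite leqnn.
  by rewrite orbT.
by rewrite big_seq; elim/big_ind: _ => [//|x y kx ky|m1 /ge //]; rewrite leq_min kx.
Qed.

Section Multiplicity.
Variables (R : realType) (n : nat).
Local Notation C := (complex R).
Implicit Types (F G : {mpoly C[n.+1]}) (v : 'rV[C]_n.+1).

Definition shift_map v (i : 'I_n.+1) : {mpoly C[n.+1]} := 'X_i + (v 0 i)%:MP.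

Lemma shiftK v F : psub (shift_map (- v)) (psub (shift_map v) F) = F.
Proof.
rewrite psub_psub -[RHS]psub_id; apply: psub_eq => i.
by rewrite rmorphD /= psubX comp_mpolyC /shift_map mxE mpolyCN subrK.
Qed.

Lemma shift_neq0 v F : F != 0 -> psub (shift_map v) F != 0.
Proof.
by apply: contraNneq => E; rewrite -(shiftK v F) E raddf0.
Qed.

Lemma mult_eq v F k : has_order mdeg (psub (shift_map v) F) k -> mult v F = k.
Proof. exact: bigmin_has_order. Qed.

Lemma mult_has_order v F : F != 0 -> has_order mdeg (psub (shift_map v) F) (mult v F).
Proof.
by move=> /(shift_neq0 v) /(has_order_ex mdeg)[k hk]; rewrite (mult_eq hk).
Qed.

Lemma multM v F G : F != 0 -> G != 0 -> mult v (F * G) = (mult v F + mult v G)%N.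
Proof.
move=> F0 G0; apply: mult_eq; rewrite rmorphM /=.
by apply: has_orderM; apply: mult_has_order.
Qed.

Lemma multZ v c F : c != 0 -> mult v (c *: F) = mult v F.
Proof.
have [->|F0 c0] := eqVneq F 0; first by rewrite scaler0.
by apply: mult_eq; rewrite comp_mpolyZ; apply/has_orderZ/mult_has_order.
Qed.

Lemma meval_shift v F w :
  (psub (shift_map v) F).@[w] = F.@[fun i => w i + v 0 i].
Proof.
by rewrite meval_psub; apply: meval_eq => i; rewrite mevalD mevalXU mevalC.
Qed.

Lemma mult_nonvanishing v F : F.@[v 0] != 0 -> mult v F = 0%N.
Proof.
move=> Fv; apply: mult_eq; split=> //; exists 0%MM; last exact: mdeg0.
rewrite mcoeff_msupp mcoeff0_meval meval_shift.
by rewrite (@meval_eq _ _ _ (v 0)) // => i; rewrite add0r.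
Qed.

(** Translating a polynomial does not raise its degree. *)
Lemma mult_le_deg v F d : F != 0 -> F \is d.-homog -> (mult v F <= d)%N.
Proof.
move=> F0 hF; have [_ [m mF <-]] := mult_has_order v F0.
have hT i : degree_le 1 (shift_map v i).
  move=> p /msuppD_le; rewrite mem_cat msuppX msuppC mem_seq1.
  by case: ifP => _ /orP[]; rewrite ?mem_seq1 // => /eqP ->;
    rewrite ?mdeg1 ?mdeg0.
have hd : degree_le d F by move=> p /(dhomog_mf hF) <-.
exact: degree_le_psub hT hd _ mF.
Qed.

Definition image_point (T : 'I_n.+1 -> {mpoly C[n.+1]}) v : 'rV[C]_n.+1 :=
  \row_i (T i).@[v 0].

(** In coordinates centred at [v] and at its image the map has no constant term, so
    substituting it cannot lower orders. Equality follows for invertible maps, by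
    applying this to the inverse as well. *)
Lemma mult_psub_ge T v F : F != 0 -> psub T F != 0 ->
  (mult (image_point T v) F <= mult v (psub T F))%N.
Proof.
move=> F0 TF0; apply: order_ge_le (mult_has_order v TF0) _.
pose S i := psub (shift_map v) (T i) - ((T i).@[v 0])%:MP.
have -> : psub (shift_map v) (psub T F) = psub S (psub (shift_map (image_point T v)) F).
  rewrite !psub_psub; apply: psub_eq => i.
  by rewrite rmorphD /= psubX comp_mpolyC /S mxE subrK.
apply: order_ge_psub (mult_has_order _ F0).1 => i /=; rewrite mdeg1.
apply: order_ge1; rewrite mevalB mevalC meval_shift.
by rewrite (@meval_eq _ _ _ (v 0)) ?subrr // => j; rewrite add0r.
Qed.

Lemma mult_scale c v F d : c != 0 -> F != 0 -> F \is d.-homog ->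
  mult (c *: v) F = mult v F.
Proof.
have le c' v' : c' != 0 -> F != 0 -> F \is d.-homog ->
    (mult (c' *: v') F <= mult v' F)%N.
  move=> c0 F0 hF; pose T i := c'%:MP * 'X_i : {mpoly C[n.+1]}.
  have E : psub T F = (c' ^+ d) *: F.
    by rewrite (psub_scale _ _ hF) psub_id -rmorphXn mul_mpolyC.
  have cd0 : c' ^+ d != 0 by rewrite expf_neq0.
  rewrite -(multZ v' F cd0) -E.
  have -> : c' *: v' = image_point T v'.
    by apply/rowP => i; rewrite !mxE mevalM mevalC mevalXU.
  by apply: mult_psub_ge => //; rewrite E scaler_eq0 negb_or cd0.
move=> c0 F0 hF; apply/eqP; rewrite eqn_leq; apply/andP; split.
  exact: le.
have E : v = c^-1 *: (c *: v) by rewrite scalerA (mulVf c0) scale1r.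
by rewrite {1}E; apply: le => //; rewrite invr_eq0.
Qed.

(** The row vector [x] is replaced by [x *m A]. *)
Definition lin_map (A : 'M[C]_n.+1) (i : 'I_n.+1) : {mpoly C[n.+1]} :=
  \sum_k A k i *: 'X_k.

Lemma image_point_lin A v : image_point (lin_map A) v = v *m A.
Proof.
apply/rowP => i; rewrite !mxE raddf_sum /=; apply: eq_bigr => k _.
by rewrite mevalZ mevalXU mulrC.
Qed.

Lemma lin_lin A B F : psub (lin_map B) (psub (lin_map A) F) = psub (lin_map (B *m A)) F.
Proof.
rewrite psub_psub; apply: psub_eq => i; rewrite raddf_sum /=.
under eq_bigr => k _ do rewrite comp_mpolyZ psubX scaler_sumr.
rewrite exchange_big; apply: eq_bigr => l _ /=.
rewrite mxE scaler_suml; apply: eq_bigr => k _.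
by rewrite scalerA mulrC.
Qed.

Lemma lin_scalar c d F : F \is d.-homog -> psub (lin_map c%:M) F = c ^+ d *: F.
Proof.
move=> hF; rewrite (@psub_eq _ _ _ _ (fun i => c%:MP * 'X_i)).
  by rewrite (psub_scale _ _ hF) psub_id -rmorphXn mul_mpolyC.
move=> i; rewrite /lin_map (bigD1 i) //= mxE eqxx mulr1n mul_mpolyC.
by rewrite big1 ?addr0 // => k ki; rewrite mxE (negPf ki) scale0r.
Qed.

Lemma lin_Kadj A F d : F \is d.-homog ->
  psub (lin_map (\adj A)) (psub (lin_map A) F) = \det A ^+ d *: F.
Proof. by move=> hF; rewrite lin_lin mul_adj_mx; apply: lin_scalar. Qed.

Lemma dhomog_lin A F d : F \is d.-homog -> psub (lin_map A) F \is d.-homog.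
Proof.
move=> hF; rewrite -[d]muln1; apply: dhomog_psub_deg hF => i.
by apply: rpred_sum => k _; apply: rpredZ; rewrite dhomogX /= mdeg1.
Qed.

Lemma lin_neq0 A F d : \det A != 0 -> F \is d.-homog -> F != 0 ->
  psub (lin_map A) F != 0.
Proof.
move=> A0 hF; apply: contraNneq => E; have := lin_Kadj A hF.
rewrite E raddf0 => /esym/eqP; rewrite scaler_eq0 => /orP[|//].
by rewrite expf_eq0 (negPf A0) andbF.
Qed.

(** The adjugate serves as the inverse map; it differs from the inverse by a scalar,
    which affects neither the multiplicities of a form nor a point of projective
    space. *)
Lemma mult_lin A F d v : \det A != 0 -> F \is d.-homog -> F != 0 ->
  mult v (psub (lin_map A) F) = mult (v *m A) F.
Proof.
move=> A0 hF F0; have AF0 := lin_neq0 A0 hF F0; have hAF := dhomog_lin A hF.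
have d0 : \det A ^+ d != 0 by rewrite expf_neq0.
apply/eqP; rewrite eqn_leq; apply/andP; split; last first.
  by rewrite -(image_point_lin A v); apply: mult_psub_ge.
rewrite -(mult_scale v A0 AF0 hAF) -(multZ (v *m A) F d0) -(lin_Kadj A hF).
have -> : \det A *: v = image_point (lin_map (\adj A)) (v *m A).
  by rewrite image_point_lin -mulmxA mul_mx_adj mul_mx_scalar.
apply: mult_psub_ge; first exact: AF0.
by rewrite (lin_Kadj A hF) scaler_eq0 negb_or d0.
Qed.

Lemma irreducible_lin A d F : \det A != 0 -> irreducible_form d F ->
  irreducible_form d (psub (lin_map A) F).
Proof.
move=> A0 [F0 hF dgt irr]; split=> //.
- exact: lin_neq0 hF F0.
- exact: dhomog_lin.
move=> e1 e2 U V hU hV E; have d0 : \det A ^+ d != 0 by rewrite expf_neq0.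
have := lin_Kadj A hF; rewrite E rmorphM /= => E2.
apply: (irr _ _ ((\det A ^+ d)^-1 *: psub (lin_map (\adj A)) U)
   (psub (lin_map (\adj A)) V)); rewrite ?rpredZ ?dhomog_lin //.
by rewrite -scalerAl E2 scalerA mulVf // scale1r.
Qed.

(** Around the coordinate point the monomial [x^m] has order [mdeg m - m i]. No
    cancellation occurs between the leading parts, as is seen by setting ['X_i]
    to 1: a monomial of fixed degree is determined by its exponents in the other
    variables. *)
Lemma mult_coordinate i F d k : F \is d.-homog ->
  has_order (degin (predC1 i)) F k -> mult (delta_mx 0 i) F = k.
Proof.
move=> hF hk; have F0 := has_order_neq0 hk.
apply/eqP; rewrite eqn_leq; apply/andP; split; last first.
  apply: order_ge_le (mult_has_order _ F0) _; apply: order_ge_psub hk.1 => j.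
  rewrite /= deginU /= /shift_map mxE eqxx /=; case: eqP => [_|_] //=.
  by rewrite mpolyC0 addr0 => m; rewrite msuppX inE => /eqP ->; rewrite /= mdeg1.
(* Setting the [i]-th shifted variable to 0 sets ['X_i] itself to 1. *)
pose U j : {mpoly C[n.+1]} := if j == i then 0 else 'X_j.
pose T j : {mpoly C[n.+1]} := if j == i then 1 else 'X_j.
pose h (m : 'X_{1..n.+1}) := [multinom (if j == i then 0 else m j)%N | j < n.+1].
have E : psub U (psub (shift_map (delta_mx 0 i)) F) = psub T F.
  rewrite psub_psub; apply: psub_eq => j.
  rewrite rmorphD /= psubX comp_mpolyC mxE eqxx /= /U /T.
  by case: eqP => _; rewrite ?mpolyC0 ?mpolyC1 ?add0r ?addr0.
have hT m : psub T 'X_[m] = 'X_[h m].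
  rewrite psubXm [RHS]mpolyXE_id; apply: eq_bigr => j _; rewrite /T mnmE.
  by case: eqP => _; rewrite ?expr1n.
have hd m : mdeg (h m) = degin (predC1 i) m.
  rewrite mdegE /degin [RHS]big_mkcond /=; apply: eq_bigr => j _; rewrite mnmE.
  by case: eqP.
have hinj : {in msupp F &, injective h}.
  move=> a b aF bF E2; apply/mnmP => j.
  have same l : l != i -> a l = b l.
    by move=> li; move/mnmP/(_ l): E2; rewrite !mnmE (negPf li).
  have [->|/same //] := eqVneq j i.
  have := dhomog_mf hF aF; rewrite -(dhomog_mf hF bF) /= !mdegE.
  rewrite (bigD1 i isT) [in RHS](bigD1 i isT) (eq_bigr b same).
  by move=> /addIn.
have hTF : has_order mdeg (psub T F) k.
  by apply: (has_order_psub_mono (h := h) _ hinj _ hk) => m _; [exact: hT|exact: hd].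
apply: order_ge_le hTF _; rewrite -E.
apply: order_ge_psub (mult_has_order _ F0).1 => j /=; rewrite mdeg1 /U.
case: (j =P i) => _; first exact: order_ge0.
move=> m; rewrite msuppX mem_seq1 => /eqP ->.
exact: eq_leq (esym (mdeg1 j)).
Qed.

Lemma crem_crem_point v : (0 < n)%N ->
  image_point (@crem C n.+1) (image_point (@crem C n.+1) v) =
  (\prod_i v 0 i ^+ n.-1) *: v.
Proof.
move=> n0; have N2 : (2 <= n.+1)%N by [].
set w := image_point _ v; apply/rowP => i; rewrite mxE [RHS]mxE.
have -> : (crem C i).@[w 0] = (psub (@crem C n.+1) (crem C i)).@[v 0].
  by rewrite meval_psub; apply: meval_eq => j; rewrite mxE.
rewrite psub_crem_mono // crem_mnmK // mpolyXD mevalM mevalXU mulrC; congr (_ * _).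
by rewrite mevalX; apply: eq_bigr => j _; rewrite mnmE mdeg1 mul1n.
Qed.

(** Away from the coordinate hyperplanes the Cremona map is its own inverse up to a
    nonvanishing monomial, so [mult_psub_ge] applies in both directions. *)
Lemma mult_crem v F d : (0 < n)%N -> (forall i, v 0 i != 0) ->
  F != 0 -> F \is d.-homog ->
  mult v (psub (@crem _ n.+1) F) = mult (image_point (@crem _ n.+1) v) F.
Proof.
move=> n0 v0 F0 hF; have N2 : (2 <= n.+1)%N by [].
have cF0 := psub_crem_neq0 N2 hF F0.
have hcF := dhomog_crem N2 hF.
have monoE m w : ('X_[m] : {mpoly C[n.+1]}).@[w] = \prod_i w i ^+ m i.
  by rewrite mevalX.
have mono0 m w : (forall i, w i != 0) -> ('X_[m] : {mpoly C[n.+1]}).@[w] != 0.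
  by move=> w0; rewrite monoE; apply/prodf_neq0 => i _; rewrite expf_neq0.
apply/eqP; rewrite eqn_leq; apply/andP; split; last exact: mult_psub_ge.
set w := image_point _ v.
pose c := \prod_i v 0 i ^+ n.-1.
have c0 : c != 0 by apply/prodf_neq0 => i _; rewrite expf_neq0.
rewrite -(mult_scale v c0 cF0 hcF) -(crem_crem_point v n0).
have ccF0 := psub_crem_neq0 N2 hcF cF0.
apply: leq_trans (mult_psub_ge w cF0 ccF0) _.
rewrite (psub_cremK N2 hF) multM ?mpolyX_neq0 // mult_nonvanishing //.
by apply: (mono0) => i; rewrite mxE; apply: (mono0).
Qed.

End Multiplicity.

(** * Nonvanishing of polynomials *)

Section Nonvanishing.
Variable K : numDomainType.

Lemma poly_nonroot (u : {poly K}) : u != 0 -> exists t, u.[t] != 0.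
Proof.
move=> u0; pose s := [seq i%:R : K | i <- iota 0 (size u)].
have us : uniq s.
  by rewrite map_inj_uniq ?iota_uniq // => i j /eqP; rewrite eqr_nat => /eqP.
case: (boolP (all (root u) s)) => [rs|/allPn[t _ tu]]; last by exists t.
by have := max_poly_roots u0 rs us; rewrite size_map size_iota ltnn.
Qed.

(** One variable at a time: specialise the last variable to a value at which the
    coefficient of one chosen monomial in the other variables survives. *)
Lemma mpoly_nonvanishing n (P : {mpoly K[n]}) : P != 0 -> exists v, P.@[v] != 0.
Proof.
elim: n P => [|n IH] P.
  rewrite -msupp_eq0 => P0; exists (fun=> 0).
  rewrite -mcoeff0_meval -mcoeff_msupp; case: (msupp P) P0 => // m s _.
  by rewrite inE (_ : m = 0%MM) ?eqxx //; apply/mnmP; case.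
rewrite -msupp_eq0 => P0.
have [m0 m0P] : exists m, m \in msupp P.
  by case: (msupp P) P0 => // m s _; exists m; rewrite inE eqxx.
pose restr (m : 'X_{1..n.+1}) := [multinom m (lift ord_max i) | i < n].
(* The coefficient of [restr m0], as a polynomial in the last variable. *)
pose u : {poly K} :=
  \sum_(m <- msupp P) (P@_m * (restr m == restr m0)%:R) *: 'X^(m ord_max).
have u0 : u != 0.
  apply/eqP => /(congr1 (coefp (m0 ord_max))); rewrite /= coef0 coef_sum.
  rewrite (bigD1_seq m0) ?msupp_uniq //= coefZ coefXn !eqxx !mulr1.
  rewrite big1 ?addr0; first by apply/eqP; rewrite -mcoeff_msupp.
  move=> m mm0; rewrite coefZ coefXn; case: eqP => E1; last by rewrite mulr0 mul0r.
  case: eqP => E2; last by rewrite mulr0.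
  case/eqP: mm0; apply/mnmP => i; case: (unliftP ord_max i) => [j ->|->] //.
  by have /mnmP/(_ j) := E1; rewrite !mnmE.
have [t ut] := poly_nonroot u0.
pose T (i : 'I_n.+1) : {mpoly K[n]} :=
  if unlift ord_max i is Some j then 'X_j else t%:MP.
have [|v hv] := IH (psub T P).
  apply/eqP => /(congr1 (mcoeff (restr m0))); rewrite mcoeff0 psubE raddf_sum /=.
  apply/eqP; move: ut; rewrite horner_sum; congr (_ != 0).
  apply: eq_bigr => m _; rewrite hornerZ hornerXn mcoeffZ -mulrA; congr (_ * _).
  have -> : \prod_i T i ^+ m i = t ^+ m ord_max *: 'X_[restr m].
    rewrite (bigD1_ord ord_max) //= /T unlift_none -rmorphXn mul_mpolyC.
    congr (_ *: _); rewrite [RHS]mpolyXE_id; apply: eq_bigr => i _.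
    by rewrite liftK mnmE.
  by rewrite mcoeffZ mcoeffX mulrC.
by exists (fun i => (T i).@[v]); rewrite -meval_psub.
Qed.

Lemma mpoly_ext n (P Q : {mpoly K[n]}) : (forall v, P.@[v] = Q.@[v]) -> P = Q.
Proof.
move=> E; apply/eqP; rewrite -subr_eq0; apply/negPn/negP.
by move=> /mpoly_nonvanishing[v]; rewrite mevalB E subrr eqxx.
Qed.

End Nonvanishing.

(** * Cremona maps on configurations of points *)

Section CremonaConfig.
Variables (n s : nat).

(** The indices of the [n+1] base points of a Cremona map, in order. *)
Definition frame := {f : {ffun 'I_n.+1 -> 'I_s} | injectiveb f}.

Lemma frame_inj (f : frame) : injective (val f).
Proof. exact/injectiveP/(valP f). Qed.

Definition exchange (f : 'I_n.+1 -> 'I_s) i j k := if k == i then j else f k.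

Lemma frame_of_inj (h : 'I_n.+1 -> 'I_s) : injective h ->
  exists f : frame, val f =1 h.
Proof.
move=> hinj; have hb : injectiveb (finfun h).
  by apply/injectiveP => a b; rewrite !ffunE => /hinj.
exists (exist (fun f : {ffun 'I_n.+1 -> 'I_s} => injectiveb f) _ hb) => i.
by rewrite /= ffunE.
Qed.

Lemma exchange_frame (f : frame) i j : (forall k, val f k != j) ->
  exists h : frame, val h =1 exchange (val f) i j.
Proof.
move=> fj; apply: frame_of_inj => a b; rewrite /exchange.
case: (a =P i) => [->|_]; case: (b =P i) => [-> //|_].
- by move/esym/eqP; rewrite (negPf (fj b)).
- by move/eqP; rewrite (negPf (fj a)).
- exact: frame_inj.
Qed.

(** Coordinates of the [j]-th point in the frame, up to the determinant of the
    frame; the adjugate keeps them polynomial in the points. *)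
Definition frame_coord (A : comNzRingType) (f : 'I_n.+1 -> 'I_s)
    (p : 'M[A]_(s, n.+1)) j :=
  row j p *m \adj (rowsub f p).

Definition crem_point (A : comNzRingType) (v : 'rV[A]_n.+1) :=
  \row_i \prod_(k | k != i) v 0 k.

(** The frame is moved to the coordinate points, then the standard Cremona map is
    applied to the other points. It makes sense over any commutative ring, so it
    can be applied to indeterminate points as well as to actual ones. *)
Definition cremona_config (A : comNzRingType) (f : 'I_n.+1 -> 'I_s)
    (p : 'M[A]_(s, n.+1)) : 'M[A]_(s, n.+1) :=
  \matrix_(j, i) if [pick k | f k == j] is Some k then (k == i)%:R
                 else crem_point (frame_coord f p j) 0 i.

Lemma map_frame_coord (A B : comNzRingType) (phi : {rmorphism A -> B}) f p j :
  map_mx phi (frame_coord f p j) = frame_coord f (map_mx phi p) j.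
Proof. by rewrite /frame_coord map_mxM map_row map_mx_adj map_mxsub. Qed.

Lemma map_cremona_config (A B : comNzRingType) (phi : {rmorphism A -> B}) f p :
  map_mx phi (cremona_config f p) = cremona_config f (map_mx phi p).
Proof.
apply/matrixP => j i; rewrite !mxE; case: pickP => [k _|_].
  by rewrite rmorph_nat.
rewrite rmorph_prod; apply: eq_bigr => k _.
by rewrite -map_frame_coord [in RHS]mxE.
Qed.

End CremonaConfig.

Section General.
Variables (R : realType) (n s : nat).
Local Notation C := (complex R).
Local Notation frame := (frame n s).
Local Notation config := ('M[C]_(s, n.+1)).
Local Notation cpoly := {mpoly C[s * n.+1]}.
Implicit Types (p q : config) (f : frame) (w : seq frame).

Definition generic_config (A : comNzRingType) : 'M[{mpoly A[s * n.+1]}]_(s, n.+1) :=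
  \matrix_(j, i) 'X_(mxvec_index j i).

Definition config_eval p (P : cpoly) := P.@[mxvec p 0].

Lemma map_generic p : map_mx (meval (mxvec p 0)) (generic_config C) = p.
Proof. by apply/matrixP => j i; rewrite !mxE mevalXU mxvecE. Qed.

Definition minors : cpoly := \prod_(f : frame) \det (rowsub (val f) (generic_config C)).

Lemma minors_at p : config_eval p minors = \prod_(f : frame) \det (rowsub (val f) p).
Proof.
rewrite /config_eval /minors rmorph_prod; apply: eq_bigr => f _.
by rewrite -det_map_mx map_mxsub map_generic.
Qed.

Fixpoint word_poly w : cpoly :=
  if w is f :: w' then
    psub (mxvec (cremona_config (val f) (generic_config C)) 0) (word_poly w')
  else minors.

Lemma word_poly_at f w p :
  config_eval p (word_poly (f :: w)) =
  config_eval (cremona_config (val f) p) (word_poly w).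
Proof.
rewrite /config_eval /= meval_psub; apply: meval_eq => k.
case/mxvec_indexP: k => j i; rewrite !mxvecE.
have := map_cremona_config (meval (mxvec p 0)) (val f) (generic_config C).
by rewrite map_generic => <-; rewrite [in RHS]mxE.
Qed.

(** Linearly general position after every sequence of Cremona maps: [word_poly w] is
    the product of the maximal minors of the configuration obtained by following
    the frames in [w]. *)
Definition cremona_general p := forall w, config_eval p (word_poly w) != 0.

Lemma general_minor p f : cremona_general p -> \det (rowsub (val f) p) != 0.
Proof.
by move=> /(_ [::]); rewrite minors_at => /prodf_neq0; apply.
Qed.

Lemma general_cremona p f :
  cremona_general p -> cremona_general (cremona_config (val f) p).
Proof. by move=> gp w; rewrite -word_poly_at. Qed.

(** The scalar is left existential: under a Cremona map the rescaling of a base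
    point also acts through a diagonal change of coordinates, and tracking it as a
    character would involve negative exponents. *)
Definition semi_invariant (P : cpoly) :=
  (forall l : 'rV[C]_s, (forall j, l 0 j != 0) ->
    exists c, forall p, config_eval (diag_mx l *m p) P = c * config_eval p P) /\
  (forall g : 'M[C]_n.+1, \det g != 0 ->
    exists c, forall p, config_eval (p *m g) P = c * config_eval p P).

Lemma rowsub_diag (f : 'I_n.+1 -> 'I_s) (l : 'rV[C]_s) p :
  rowsub f (diag_mx l *m p) = diag_mx (\row_i l 0 (f i)) *m rowsub f p.
Proof. by apply/matrixP => i k; rewrite !mul_diag_mx !mxE. Qed.

Lemma semi_invariant_minors : semi_invariant minors.
Proof.
split=> [l l0|g g0].
  exists (\prod_(f : frame) \det (diag_mx (\row_i l 0 (val f i)))) => p.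
  rewrite !minors_at -big_split; apply: eq_bigr => f _.
  by rewrite rowsub_diag det_mulmx.
exists (\prod_(f : frame) \det g) => p.
rewrite !minors_at -big_split; apply: eq_bigr => f _.
by rewrite -mul_rowsub_mx det_mulmx mulrC.
Qed.

(** Cramer's rule. *)
Lemma frame_coord_minor (f : 'I_n.+1 -> 'I_s) p j i :
  frame_coord f p j 0 i = \det (rowsub (exchange f i j) p).
Proof.
rewrite (expand_det_row _ i) mxE; apply: eq_bigr => k _.
rewrite !mxE /exchange eqxx; congr (_ * _); rewrite /cofactor; congr (_ * \det _).
apply/matrixP => a b; rewrite !mxE; case: eqP => // E.
by have := neq_lift i a; rewrite E eqxx.
Qed.

Lemma frame_coord_scale (f : 'I_n.+1 -> 'I_s) (l : 'rV[C]_s) p j i :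
  frame_coord f (diag_mx l *m p) j 0 i =
  l 0 j * (\prod_(k | k != i) l 0 (f k)) * frame_coord f p j 0 i.
Proof.
apply: etrans (frame_coord_minor _ _ _ _) _.
rewrite rowsub_diag det_mulmx det_diag.
congr (_ * _); last exact: esym (frame_coord_minor _ _ _ _).
rewrite (bigD1 i) // mxE /exchange eqxx; congr (_ * _).
by apply: eq_bigr => k /negPf ki; rewrite mxE ki.
Qed.

Lemma frame_coord_mulr (f : 'I_n.+1 -> 'I_s) (g : 'M[C]_n.+1) p j i :
  frame_coord f (p *m g) j 0 i = \det g * frame_coord f p j 0 i.
Proof.
apply: etrans (frame_coord_minor _ _ _ _) _.
rewrite -mul_rowsub_mx det_mulmx mulrC; congr (_ * _).
exact: esym (frame_coord_minor _ _ _ _).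
Qed.

(** Rescaling the base points rescales the coordinates in the frame, which the
    Cremona map turns into another diagonal matrix. The transformed configuration
    is therefore well defined only up to rescaling of the points and a diagonal
    change of coordinates; this is why invariance under linear maps has to be
    carried along. *)
Lemma cremona_config_scale (f : 'I_n.+1 -> 'I_s) (l : 'rV[C]_s) :
  (forall j, l 0 j != 0) ->
  exists (m : 'rV[C]_s) (e : 'rV[C]_n.+1),
    [/\ forall j, m 0 j != 0, forall i, e 0 i != 0 &
    forall p, cremona_config f (diag_mx l *m p) =
              diag_mx m *m cremona_config f p *m diag_mx e].
Proof.
move=> l0.
have [d dE] : exists d : 'I_n.+1 -> C,
    forall k, d k = \prod_(k' | k' != k) l 0 (f k') by eexists.
have d0 k : d k != 0 by rewrite dE; apply/prodf_neq0 => k' _.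
have [e eE] : exists e : 'rV[C]_n.+1, forall i, e 0 i = \prod_(k | k != i) d k.
  by exists (\row_i \prod_(k | k != i) d k) => i; rewrite mxE.
have e0 i : e 0 i != 0 by rewrite eE; apply/prodf_neq0 => k' _.
have [m mE] : exists m : 'rV[C]_s, forall j,
    m 0 j = if [pick k | f k == j] is Some k then (e 0 k)^-1 else l 0 j ^+ n.
  by exists (\row_j if [pick k | f k == j] is Some k then (e 0 k)^-1 else l 0 j ^+ n)
    => j; rewrite mxE.
exists m, e; split=> // [j|p].
  by rewrite mE; case: pickP => [k _|_]; rewrite ?invr_eq0 ?expf_neq0.
apply/matrixP => j i; rewrite mul_mx_diag [in RHS]mxE (mul_diag_mx m) [in RHS]mxE.
rewrite mE [LHS]mxE [in RHS]mxE.
case: pickP => [k _|_].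
  have [->|_] := eqVneq k i; last by rewrite mulr0 mul0r.
  by rewrite mulr1 (mulVf (e0 i)).
rewrite [LHS]mxE [in RHS]mxE.
apply: etrans (eq_bigr _ (fun k _ => frame_coord_scale f l p j k)) _.
under eq_bigr => k _ do rewrite -dE.
rewrite !big_split /= mulrAC eE; congr (_ * _ * _).
by rewrite prodr_const cardC1 card_ord.
Qed.

Lemma cremona_config_mulr (f : 'I_n.+1 -> 'I_s) (g : 'M[C]_n.+1) : \det g != 0 ->
  exists m : 'rV[C]_s, (forall j, m 0 j != 0) /\
    forall p, cremona_config f (p *m g) = diag_mx m *m cremona_config f p.
Proof.
move=> g0.
have [m mE] : exists m : 'rV[C]_s, forall j,
    m 0 j = if [pick k | f k == j] is Some k then 1 else \det g ^+ n.
  by exists (\row_j if [pick k | f k == j] is Some k then 1 else \det g ^+ n)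
    => j; rewrite mxE.
exists m; split=> [j|p].
  by rewrite mE; case: pickP => [k _|_]; rewrite ?oner_eq0 ?expf_neq0.
apply/matrixP => j i; rewrite (mul_diag_mx m) [in RHS]mxE mE [LHS]mxE [in RHS]mxE.
case: pickP => [k _|_]; first by rewrite mul1r.
rewrite [LHS]mxE [in RHS]mxE.
apply: etrans (eq_bigr _ (fun k _ => frame_coord_mulr f g p j k)) _.
by rewrite !big_split /= prodr_const cardC1 card_ord.
Qed.

Lemma semi_invariant_word w : semi_invariant (word_poly w).
Proof.
elim: w => [|f w [IHl IHg]]; first exact: semi_invariant_minors.
split=> [l l0|g g0].
  have [m [e [m0 e0 E]]] := cremona_config_scale (val f) l0.
  have [c hc] := IHl _ m0.
  have [|c' hc'] := IHg (diag_mx e).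
    by rewrite det_diag; apply/prodf_neq0 => i _.
  by exists (c' * c) => p; rewrite !word_poly_at E hc' hc mulrA.
have [m [m0 E]] := cremona_config_mulr (val f) g0.
have [c hc] := IHl _ m0.
by exists c => p; rewrite !word_poly_at E hc.
Qed.

Definition group_degree (j : 'I_s) (m : 'X_{1..s * n.+1}) :=
  (\sum_(i < n.+1) m (mxvec_index j i))%N.

(** Doubling the coordinates of one point multiplies each monomial by 2 to the power
    of its degree in that point. The polynomial being an eigenvector, these powers
    agree, hence so do the degrees. *)
Lemma semi_invariant_multihomog P : semi_invariant P -> @multihomog R n s P.
Proof.
move=> [hl _]; have [->|P0] := eqVneq P 0.
  by exists (fun=> 0%N) => m; rewrite msupp0.
have key j : exists c, forall m, m \in msupp P -> 2%:R ^+ group_degree j m = c :> C.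
  pose l : 'rV[C]_s := \row_k if k == j then 2%:R else 1.
  have l0 k : l 0 k != 0.
    by rewrite mxE; case: ifP => _; rewrite ?pnatr_eq0 ?oner_eq0.
  have [c hc] := hl l l0; exists c => m mP.
  pose a (k : 'I_(s * n.+1)) : C := mxvec (diag_mx l *m const_mx 1) 0 k.
  pose T k : {mpoly C[s * n.+1]} := (a k) *: 'X_k.
  have E : psub T P = c *: P.
    apply: mpoly_ext => v; rewrite mevalZ meval_psub.
    have := hc (vec_mx (\row_k v k)); rewrite /config_eval vec_mxK.
    rewrite (@meval_eq _ _ (fun k => (\row_k v k) 0 k) v); last by move=> k; rewrite mxE.
    move=> <-; apply: meval_eq => k; rewrite mevalZ mevalXU /a.
    by case/mxvec_indexP: k => j' i'; rewrite !mxvecE !mul_diag_mx !mxE mulr1.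
  have Tm (p : 'X_{1..s * n.+1}) : psub T 'X_[p] = 2%:R ^+ group_degree j p *: 'X_[p].
    rewrite psubXm /T; under eq_bigr do rewrite exprZn.
    rewrite scaler_prod -mpolyXE_id; congr (_ *: _).
    rewrite (reindex _ (curry_mxvec_bij _ _)) /=.
    transitivity (\prod_k \prod_i a (mxvec_index k i) ^+ p (mxvec_index k i)).
      by rewrite pair_bigA; apply: eq_bigr => -[k i] _.
    rewrite (bigD1 j) //= [X in _ * X]big1 ?mulr1.
      rewrite /group_degree expr_sum; apply: eq_bigr => i _.
      by rewrite /a mxvecE mul_diag_mx !mxE eqxx mulr1.
    move=> k kj; apply: big1 => i _.
    by rewrite /a mxvecE mul_diag_mx !mxE (negPf kj) mulr1 expr1n.
  have := congr1 (mcoeff m) E; rewrite mcoeffZ comp_mpolyEX raddf_sum /=.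
  under eq_bigr => q _ do rewrite Tm mcoeffZ mcoeffZ mcoeffX.
  rewrite (bigD1_seq m) ?msupp_uniq //= eqxx big1 ?addr0; last first.
    by move=> q /negPf ->; rewrite !mulr0.
  by rewrite mulr1 mulrC; apply: mulIf; rewrite -mcoeff_msupp.
have [m0 m0P] : exists m, m \in msupp P.
  move: P0; rewrite -msupp_eq0; case: (msupp P) => // m ms _.
  by exists m; rewrite inE eqxx.
exists (group_degree^~ m0) => m mP j; have [c hc] := key j.
have := hc _ mP; rewrite -(hc _ m0P).
by apply: ieexprIn; rewrite ?ltr0n ?pnatr_eq1.
Qed.

Lemma frame_coord_frame f p (i : 'I_n.+1) :
  frame_coord (val f) p (val f i) = \det (rowsub (val f) p) *: delta_mx 0 i.
Proof.
have -> : frame_coord (val f) p (val f i) =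
    row i (rowsub (val f) p *m \adj (rowsub (val f) p)).
  by rewrite row_mul row_rowsub.
rewrite mul_mx_adj -mul_scalar_mx; apply/rowP => k.
by rewrite mul_scalar_mx !mxE eqxx eq_sym mulr_natr.
Qed.

Lemma frame_coord_neq0 f p j i :
  (forall f : frame, \det (rowsub (val f) p) != 0) ->
  (forall k, val f k != j) -> frame_coord (val f) p j 0 i != 0.
Proof.
move=> gp fj; rewrite frame_coord_minor.
have [h hE] := exchange_frame i fj.
have := gp h; congr (\det _ != 0).
by apply/matrixP => a b; rewrite !mxE hE.
Qed.

Lemma crem_pointE (v : 'rV[C]_n.+1) : crem_point v = image_point (@crem C n.+1) v.
Proof.
apply/rowP => i; rewrite !mxE mevalX [RHS](bigD1 i isT) /=.
rewrite crem_mnmE /= deginU /= eqxx expr0 mul1r; apply: eq_bigr => k ki.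
by rewrite crem_mnmE /= deginU /= eq_sym ki expr1.
Qed.

Lemma cremona_config_frame f p i :
  row (val f i) (cremona_config (val f) p) = delta_mx 0 i.
Proof.
apply/rowP => k; rewrite !mxE; case: pickP => [a /eqP/frame_inj -> |/(_ i)].
  by rewrite eqxx eq_sym.
by rewrite eqxx.
Qed.

Lemma cremona_config_other f p j : (forall k, val f k != j) ->
  row j (cremona_config (val f) p) = crem_point (frame_coord (val f) p j).
Proof.
move=> fj; apply/rowP => k; rewrite mxE mxE.
by case: pickP => [a|//]; rewrite (negPf (fj a)).
Qed.

(** After the first Cremona map the frame consists of the coordinate points, so the
    second one is the standard map and brings the coordinates in the frame back;
    multiplying by the frame recovers the points. *)
Lemma cremona_configK f q : (0 < n)%N ->
  (forall f : frame, \det (rowsub (val f) q) != 0) ->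
  exists m : 'rV[C]_s, (forall j, m 0 j != 0) /\
    q = diag_mx m *m cremona_config (val f) (cremona_config (val f) q)
          *m rowsub (val f) q.
Proof.
move=> n0 gq.
have [g gE] : exists g, g = rowsub (val f) q by eexists.
have g0 : \det g != 0 by rewrite gE.
have [c cE] : exists c : 'I_s -> C, forall j,
  c j = \prod_i frame_coord (val f) q j 0 i ^+ n.-1 by eexists.
have [m mE] : exists m : 'rV[C]_s, forall j,
    m 0 j = if [pick k | val f k == j] is Some k then 1 else (c j * \det g)^-1.
  by exists (\row_j if [pick k | val f k == j] is Some k then 1
                    else (c j * \det g)^-1) => j; rewrite mxE.
have c0 j : (forall k, val f k != j) -> c j != 0.
  move=> fj; rewrite cE; apply/prodf_neq0 => i _; rewrite expf_neq0 //.
  exact: frame_coord_neq0.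
have out j : [pick k | val f k == j] = None -> forall k, val f k != j.
  by case: pickP => // fj _ k; rewrite fj.
exists m; split=> [j|].
  rewrite mE; case E : [pick k | _] => [k|]; first exact: oner_neq0.
  by rewrite invr_eq0 mulf_neq0 // c0 //; apply: out.
rewrite -gE; apply/row_matrixP => j.
rewrite -mulmxA row_mul row_diag_mx -scalemxAl -rowE mE row_mul.
case E : [pick k | _] => [k|].
  have {E} fk : val f k = j by move: E; case: pickP => // a /eqP fa [<-].
  rewrite -fk cremona_config_frame scale1r -rowE gE.
  by rewrite row_rowsub.
have fj := out _ E; rewrite (cremona_config_other _ fj).
have one : rowsub (val f) (cremona_config (val f) q) = 1%:M.
  by apply/row_matrixP => i; rewrite row_rowsub cremona_config_frame row1.
rewrite /frame_coord one adj1 mulmx1 (cremona_config_other _ fj) crem_pointE crem_pointE.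
rewrite (crem_crem_point _ n0) -cE -scalemxAl /frame_coord -gE -mulmxA mul_adj_mx.
rewrite mul_mx_scalar !scalerA -mulrA mulVf ?scale1r //.
by rewrite mulf_neq0 // c0.
Qed.

Lemma config_eval_neq0 p P : config_eval p P != 0 -> P != 0.
Proof. by apply: contraNneq => ->; rewrite /config_eval meval0. Qed.

Lemma config_nonvanishing P : P != 0 -> exists p, config_eval p P != 0.
Proof.
move=> /mpoly_nonvanishing[v hv]; exists (vec_mx (\row_k v k)).
by rewrite /config_eval vec_mxK (@meval_eq _ _ _ v) // => k; rewrite mxE.
Qed.

(** Points on the rational normal curve have Vandermonde minors. *)
Lemma minors_neq0 : minors != 0.
Proof.
apply: (@config_eval_neq0 (\matrix_(j, i) j%:R ^+ i)).
rewrite minors_at; apply/prodf_neq0 => f _.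
have -> : rowsub (val f) (\matrix_(j < s, i < n.+1) (j%:R : C) ^+ i) =
    (Vandermonde n.+1 (\row_i (val f i)%:R))^T.
  by apply/matrixP => a b; rewrite !mxE.
rewrite det_tr det_Vandermonde; apply/prodf_neq0 => a _.
apply/prodf_neq0 => b ab; rewrite !mxE subr_eq0 eqr_nat.
by rewrite val_eqE (inj_eq (@frame_inj _ _ f)) gt_eqF.
Qed.

(** At a configuration [q] where the condition for the shorter word holds, the
    configuration obtained from [q] by the Cremona map satisfies the condition for
    the longer word, because transforming it again gives back [q] up to
    semi-invariance. *)
Lemma word_poly_neq0 w : (0 < n)%N -> word_poly w != 0.
Proof.
move=> n0; elim: w => [|f w IH]; first exact: minors_neq0.
have [q] := config_nonvanishing (mulf_neq0 IH minors_neq0).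
rewrite /config_eval mevalM mulf_eq0 negb_or -!/(config_eval _ _) => /andP[qw].
rewrite minors_at => /prodf_neq0 qm.
have gq f' : \det (rowsub (val f') q) != 0 by apply: qm.
have [m [m0 E]] := cremona_configK f n0 gq.
apply: (@config_eval_neq0 (cremona_config (val f) q)); rewrite word_poly_at.
have [hl hg] := semi_invariant_word w.
have [c hc] := hl m m0; have [c' hc'] := hg _ (gq f).
apply: contraNneq qw => z.
by rewrite E hc' hc z !mulr0.
Qed.

(** There are countably many words, and each excludes the zero locus of a single
    nonzero multihomogeneous polynomial. *)
Lemma for_general_points_cremona (Q : config -> Prop) : (0 < n)%N ->
  (forall p, cremona_general p -> Q p) -> for_general_points Q.
Proof.
move=> n0 gQ.
exists (fun k P => P = word_poly (odflt [::] (unpickle k))); split=> [k|p _ hp].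
  set w := odflt _ _; split.
    by move=> P ->; apply/semi_invariant_multihomog/semi_invariant_word.
  (* The extra factor keeps every row of the configuration nonzero. *)
  pose X : cpoly := \prod_(j < s) 'X_(mxvec_index j ord0).
  have X0 : X != 0 by apply/prodf_neq0 => j _; apply: mpolyX_neq0.
  have [p] := config_nonvanishing (mulf_neq0 (word_poly_neq0 w n0) X0).
  rewrite /config_eval mevalM mulf_eq0 negb_or => /andP[pw pX].
  exists p; split=> [j|/(_ _ erefl)]; last by move/eqP; rewrite (negPf pw).
  move: pX; rewrite rmorph_prod => /prodf_neq0/(_ j isT).
  rewrite /= mevalXU mxvecE; apply: contraNneq => /rowP/(_ ord0).
  by rewrite !mxE => ->.
apply: gQ => w; apply/eqP => z; apply: (hp (pickle w)) => P ->.
by rewrite pickleK.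
Qed.

End General.

(** * Noether's inequality *)

Section Noether.
Variables (n s : nat).
Local Notation frame := (frame n s).
Implicit Types (f : frame) (m : 'I_s -> nat).

Lemma sum_frame f (m : 'I_s -> nat) :
  (\sum_j m j = \sum_i m (val f i) + \sum_(j | j \notin codom (val f)) m j)%N.
Proof.
rewrite (bigID (mem (codom (val f)))) /=; congr (_ + _)%N.
rewrite -big_uniq /=; last by rewrite map_inj_uniq ?enum_uniq //; apply: frame_inj.
by rewrite big_map -big_enum.
Qed.

(** A frame maximising the sum of the values: a larger value outside could be
    exchanged for a smaller one inside. *)
Lemma max_frame m : (n < s)%N ->
  exists f, forall i j, j \notin codom (val f) -> (m j <= m (val f i))%N.
Proof.
move=> ns.
have [f0 _] : exists f : frame, val f =1 widen_ord ns.
  by apply: frame_of_inj => a b /(congr1 val) /= /val_inj.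
case: (@arg_maxnP _ f0 predT (fun f => \sum_i m (val f i))%N isT) => f _ fmax.
exists f => i j jf; rewrite leqNgt; apply/negP => lt.
have fj k : val f k != j.
  by apply: contraNneq jf => <-; apply: codom_f.
have [h hE] := exchange_frame i fj.
have : (\sum_k m (val h k) <= \sum_k m (val f k))%N := fmax h isT.
rewrite leqNgt => /negP; apply.
rewrite (bigD1 i) //= [X in (_ < X)%N](bigD1 i) //= hE /exchange eqxx.
rewrite [X in (_ < _ + X)%N](eq_bigr (fun k => m (val f k))) ?ltn_add2r //.
by move=> k /negPf ki; rewrite hE /exchange ki.
Qed.

(** Let [mu] be the least multiplicity on the frame. Then
    [m j * (m j - mu) <= 0] off the frame and [m j * (m j - mu) <= d * (m j - mu)]
    on it. Summing over [j], a frame with sum at most [(n-1) d] would give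
    [r + a * mu <= 0]. *)
Lemma noether_inequality (d a r : nat) m :
  (0 < d)%N -> (forall j, m j <= d)%N ->
  (\sum_j m j + a = n.+1 * d)%N -> (\sum_j m j ^ 2 = n.-1 * d ^ 2 + r)%N ->
  (0 < r)%N -> (n < s)%N ->
  exists f, (n.-1 * d < \sum_i m (val f i))%N.
Proof.
move=> d0 md hsum hsq r0 ns; have [f fmax] := max_frame m ns; exists f.
have [i0 _ imin] := @arg_minnP _ (@ord0 n) predT (fun i => m (val f i)) isT.
set mu := m (val f i0) in imin.
rewrite ltnNge; apply/negP => le.
have : (\sum_j m j ^ 2 + n.+1 * (d * mu) <=
        mu * (\sum_j m j) + d * \sum_i m (val f i))%N.
  have rest : (\sum_(j | j \notin codom (val f)) m j ^ 2 <=
               mu * \sum_(j | j \notin codom (val f)) m j)%N.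
    rewrite big_distrr; apply: leq_sum => j jf /=.
    by rewrite -mulnn leq_mul2r fmax ?orbT.
  have base : (\sum_i m (val f i) ^ 2 + n.+1 * (d * mu) <=
               mu * (\sum_i m (val f i)) + d * \sum_i m (val f i))%N.
    rewrite !big_distrr /= -big_split /=.
    have -> : (n.+1 * (d * mu) = \sum_(i < n.+1) d * mu)%N.
      by rewrite sum_nat_const card_ord.
    rewrite -big_split; apply: leq_sum => i _ /=.
    have := imin i isT; have := md (val f i).
    by move: (m (val f i)) => x; rewrite -mulnn; nia.
  rewrite (sum_frame f (fun j => m j ^ 2)%N) (sum_frame f m) mulnDr.
  by lia.
rewrite hsq; move: hsum le; set S := (\sum_j m j)%N; set T := (\sum_i m _)%N.
move=> hsum le; have : (d * T <= n.-1 * d ^ 2)%N.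
  by rewrite mulnC -mulnn mulnA leq_mul2r le orbT.
have : (mu * S <= n.+1 * (d * mu))%N.
  by rewrite mulnA -hsum mulnC leq_mul2r leq_addr orbT.
by lia.
Qed.

(** The Cremona map is an isometry for the Dolgachev-Mukai pairing and fixes the
    canonical class. With [t] the excess of the sum over the frame above
    [(n-1) d], it lowers the degree and each multiplicity on the frame by [t]. *)
Lemma cremona_numerics f m m' (d e a r : nat) :
  (n.-1 * d < \sum_i m (val f i))%N -> (e + \sum_i m (val f i) = d * n)%N ->
  (forall i, m' (val f i) + (\sum_k m (val f k) - m (val f i)) = d * n.-1)%N ->
  (forall j, j \notin codom (val f) -> m' j = m j) ->
  (\sum_j m j + a = n.+1 * d)%N -> (\sum_j m j ^ 2 = n.-1 * d ^ 2 + r)%N ->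
  (0 < n)%N ->
  (e < d)%N /\ (\sum_j m' j + a = n.+1 * e)%N /\
    (\sum_j m' j ^ 2 = n.-1 * e ^ 2 + r)%N.
Proof.
move=> hf he hfr hother hsum hsq n0.
set S := (\sum_i m (val f i))%N in hf he hfr.
have [t St] : exists t, (S = n.-1 * d + t)%N by exists (S - n.-1 * d)%N; lia.
(* The degree drops by [t] because [d * n - ((n-1) d + t) = d - t]. *)
have nE : (n = n.-1.+1)%N by lia.
have et : (e + t = d)%N.
  by move: he; rewrite St {2}nE mulnS mulnC; lia.
have bt i : (m (val f i) = m' (val f i) + t)%N.
  have := hfr i; have : (m (val f i) <= S)%N.
    by rewrite /S (bigD1 i) //= leq_addr.
  by rewrite St mulnC; lia.
have csum c : (n.+1 * c = \sum_(i < n.+1) c)%N.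
  by rewrite sum_nat_const card_ord.
have SB : (S = \sum_i m' (val f i) + n.+1 * t)%N.
  by rewrite /S csum -big_split /=; apply: eq_bigr => i _; rewrite bt.
have SQ : (\sum_i m (val f i) ^ 2 =
   \sum_i m' (val f i) ^ 2 + 2 * t * \sum_i m' (val f i) + n.+1 * t ^ 2)%N.
  rewrite csum big_distrr -!big_split /=.
  apply: eq_bigr => i _; rewrite bt; move: (m' _) => x.
  by rewrite sqrnD; clear; nia.
move: hsum hsq; rewrite (sum_frame f m) (sum_frame f (fun j => m j ^ 2)%N) -/S.
rewrite (sum_frame f m') (sum_frame f (fun j => m' j ^ 2)%N) SQ.
rewrite [in (_ + _ + a = n.+1 * e)%N](eq_bigr m hother).
have -> : (\sum_(j | j \notin codom (val f)) m' j ^ 2 =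
   \sum_(j | j \notin codom (val f)) m j ^ 2)%N.
  by apply: eq_bigr => j jf; rewrite hother.
move: (\sum_(j | _) m j)%N (\sum_(j | _) m j ^ 2)%N => X X2.
move: (\sum_i m' (val f i) ^ 2)%N (\sum_i m' (val f i))%N SB => Q B SB.
move: (S) St SB hf => {hfr he SQ bt csum hother}S0 St SB hf hsum hsq.
split; first by lia.
split; first by move: hsum; rewrite SB -et mulnDr; lia.
move: SB hsq; rewrite St; have -> : (n.+1 = n.-1 + 2)%N by lia.
rewrite -et; move: (n.-1) => k SB.
have Bm : (B + t = k * e)%N by lia.
rewrite sqrnD; nia.
Qed.

End Noether.

(** * The descent *)

Section Descent.
Variables (R : realType) (n s : nat).
Hypothesis hn : (2 <= n)%N.
Local Notation C := (complex R).
Local Notation frame := (frame n s).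
Local Notation config := ('M[C]_(s, n.+1)).
Implicit Types (p : config) (f : frame) (F : {mpoly C[n.+1]}).

Let n0 : (0 < n)%N := ltnW hn.

Lemma mult_frame_coord f p F d j : \det (rowsub (val f) p) != 0 ->
  F \is d.-homog -> F != 0 ->
  mult (frame_coord (val f) p j) (psub (lin_map (rowsub (val f) p)) F) = mult (row j p) F.
Proof.
move=> g0 hF F0; rewrite (mult_lin _ g0 hF F0) -mulmxA mul_adj_mx mul_mx_scalar.
exact: mult_scale hF.
Qed.

Lemma mult_frame f p F d i : \det (rowsub (val f) p) != 0 ->
  F \is d.-homog -> F != 0 ->
  mult (delta_mx 0 i) (psub (lin_map (rowsub (val f) p)) F) = mult (row (val f i) p) F.
Proof.
move=> g0 hF F0; rewrite -(mult_frame_coord _ g0 hF F0) frame_coord_frame.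
by rewrite (mult_scale _ g0 (lin_neq0 g0 hF F0) (dhomog_lin _ hF)).
Qed.

(** The hyperplane spanned by all points of a frame but one contains no other point
    of the configuration. *)
Lemma fundamental_hyperplane f p F i (c : C) :
  cremona_general p -> F \is 1.-homog -> F != 0 ->
  psub (lin_map (rowsub (val f) p)) F = c *: 'X_i ->
  (\sum_j mult (row j p) F ^ 2 <= n)%N.
Proof.
move=> gp hF F0 E; have g0 := general_minor f gp.
have c0 : c != 0.
  by apply: contraNneq (lin_neq0 g0 hF F0) => c0; rewrite E c0 scale0r.
have van (v : 'rV[C]_n.+1) : v 0 i != 0 -> mult v (c *: 'X_i : {mpoly C[n.+1]}) = 0%N.
  by move=> vi; apply: mult_nonvanishing; rewrite mevalZ mevalXU mulf_neq0.
rewrite (sum_frame f (fun j => mult (row j p) F ^ 2)%N) [X in (_ + X)%N]big1 ?addn0.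
  rewrite (bigD1 i) //= -(mult_frame i g0 hF F0) E van; last first.
    by rewrite mxE !eqxx oner_neq0.
  rewrite add0n; apply: (@leq_trans (\sum_(k < n.+1 | k != i) 1)%N).
    by apply: leq_sum => k _; rewrite -[X in (_ <= X)%N](exp1n 2) leq_exp2r ?mult_le_deg.
  by rewrite sum1_card cardC1 card_ord.
move=> j jf; rewrite -(mult_frame_coord j g0 hF F0) E van //.
apply: frame_coord_neq0 => [f'|k]; first exact: general_minor.
by apply: contraNneq jf => <-; apply: codom_f.
Qed.

(** The bound on the squares excludes the fundamental hyperplanes, which are the only
    irreducible hypersurfaces contracted by the Cremona map. *)
Lemma cremona_step f p F d : cremona_general p -> irreducible_form d F ->
  (n < \sum_j mult (row j p) F ^ 2)%N ->
  exists e (G : {mpoly C[n.+1]}),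
  [/\ irreducible_form e G,
      (e + \sum_i mult (row (val f i) p) F = d * n)%N,
      forall i, (mult (row (val f i) (cremona_config (val f) p)) G +
                 (\sum_k mult (row (val f k) p) F - mult (row (val f i) p) F)
                 = d * n.-1)%N &
      forall j, j \notin codom (val f) ->
        mult (row j (cremona_config (val f) p)) G = mult (row j p) F].
Proof.
move=> gp irrF sq; have [F0 hF _ _] := irrF.
have g0 := general_minor f gp; set g := rowsub (val f) p in g0.
have irr1 := irreducible_lin g0 irrF; set F1 := psub _ F in irr1.
have [F10 hF1 _ _] := irr1.
case: (reduced_or_linear irr1) => [rF1|[i [c [d1 E]]]]; last first.
  move: sq; rewrite ltnNge => /negP[]; rewrite d1 in hF.
  exact: fundamental_hyperplane gp hF F0 E.
have N2 : (2 <= n.+1)%N by [].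
have [a [b [G [e [[G0 hG rG deg] EF EG ab [ha hb]]]]]] := crem_form N2 hF1 F10 rF1.
have aE i : a i = mult (row (val f i) p) F.
  by rewrite -(mult_frame i g0 hF F0) (mult_coordinate hF1 (ha i)).
have sumE : mdeg a = (\sum_i mult (row (val f i) p) F)%N.
  by rewrite mdegE; apply: eq_bigr => i _; rewrite aE.
exists e, G; split.
- exact: (irreducible_crem N2 irr1 rF1 G0 hG rG EF EG).
- by rewrite -sumE.
- move=> i; rewrite cremona_config_frame (mult_coordinate hG (hb i)).
  by rewrite -sumE -aE; apply: ab.
move=> j jf; have fj k : val f k != j.
  by apply: contraNneq jf => <-; apply: codom_f.
rewrite (cremona_config_other _ fj) crem_pointE.
have v0 i : frame_coord (val f) p j 0 i != 0.
  by apply: frame_coord_neq0 => // f'; apply: general_minor.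
rewrite -(mult_crem n0 v0 G0 hG) EG multM ?mpolyX_neq0 //.
rewrite (mult_frame_coord j g0 hF F0) mult_nonvanishing // mevalX.
by apply/prodf_neq0 => i _; rewrite expf_neq0.
Qed.

(** Infinite descent on the degree. With at most [n] points there is no frame, but
    then [\sum m_j <= n * d] forces a hyperplane, whose multiplicities are too
    small. *)
Lemma no_irreducible_form (d a r : nat) p F :
  cremona_general p -> irreducible_form d F ->
  (a = 0 /\ r = 2 \/ a = 1 /\ r = 3)%N ->
  (\sum_j mult (row j p) F + a = n.+1 * d)%N ->
  (\sum_j mult (row j p) F ^ 2 = n.-1 * d ^ 2 + r)%N -> False.
Proof.
have [k] := ubnP d; elim: k => // k IH in d p F *.
rewrite ltnS => dk gp irrF ar hsum hsq; have [F0 hF d0 _] := irrF.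
have md j : (mult (row j p) F <= d)%N by apply: mult_le_deg.
have [sn|ns] := leqP s n.
  have le : (\sum_j mult (row j p) F <= s * d)%N.
    rewrite -[s in X in (_ <= X)%N]card_ord -sum_nat_const.
    by apply: leq_sum => j _.
  have da : (d <= a)%N.
    have : (s * d <= n * d)%N by rewrite leq_mul2r sn orbT.
    by move: hsum le; rewrite mulSn; lia.
  have [a1 [r3 d1]] : a = 1%N /\ r = 3%N /\ d = 1%N by case: ar => -[aE rE]; lia.
  have : (\sum_j mult (row j p) F ^ 2 <= \sum_j mult (row j p) F)%N.
    apply: leq_sum => j _; have := md j; rewrite d1.
    by case: (mult _ _) => [|[]].
  by rewrite hsq; move: hsum; rewrite a1 r3 d1 exp1n !muln1; lia.
have r0 : (0 < r)%N by case: ar => -[aE rE]; lia.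
have [f hf] := noether_inequality d0 md hsum hsq r0 ns.
have sq : (n < \sum_j mult (row j p) F ^ 2)%N.
  rewrite hsq; have : (n.-1 * 1 <= n.-1 * d ^ 2)%N by rewrite leq_mul2l expn_gt0 d0 orbT.
  by case: ar => -[aE rE]; lia.
have [e [G [irrG he hfr hother]]] := cremona_step f gp irrF sq.
set q := cremona_config (val f) p in hfr hother.
have [de [hsum' hsq']] := cremona_numerics hf he hfr hother hsum hsq n0.
by apply: (IH e q G _ (general_cremona f gp) irrG ar hsum' hsq'); lia.
Qed.

End Descent.

(** * Classes of divisors *)

Section Divisors.
Variables (R : realType) (n s : nat).
Local Notation C := (complex R).
Local Notation config := ('M[C]_(s, n.+1)).
Implicit Types (p : config) (F : {mpoly C[n.+1]}) (D P : divisor R n s).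

Lemma mult_const (v : 'rV[C]_n.+1) c : c != 0 -> mult v c%:MP = 0%N.
Proof. by move=> c0; apply: mult_nonvanishing; rewrite mevalC. Qed.

Lemma mult_exp (v : 'rV[C]_n.+1) F k : F != 0 -> mult v (F ^+ k) = (k * mult v F)%N.
Proof.
move=> F0; elim: k => [|k IH].
  by rewrite expr0 mul0n -mpolyC1 mult_const ?oner_neq0.
by rewrite exprS (multM _ F0) ?expf_neq0 // IH mulSn.
Qed.

Lemma exc_twist p l a (b : 'I_s -> nat) j :
  exc (divD (divMn (pullback p l) a) (excdiv R n b)) j =
  (a * mult (row j p) l + b j)%N.
Proof.
apply: etrans (ffunE _ _) _; congr (_ + _)%N; last exact: ffunE.
by apply: etrans (ffunE _ _) _; congr (_ * _)%N; apply: ffunE.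
Qed.

Lemma exc_divD_pullback D p A j :
  exc (divD D (pullback p A)) j = (exc D j + mult (row j p) A)%N.
Proof. by apply: etrans (ffunE _ _) _; congr (_ + _)%N; apply: ffunE. Qed.

(** The degree and the multiplicities of both sides of a linear equivalence are
    compared; the auxiliary hyperplane [l] contributes only to the degree. *)
Lemma class_of_divisor p D delta d : hyp D != 0 -> hyp D \is d.-homog ->
  has_class p D delta ->
  delta = (d%:Z, \row_j ((exc D j)%:Z - (mult (row j p) (hyp D))%:Z)).
Proof.
move=> F0 hF [l [a [a' [b [b' [[l0 hl] lp -> [A [B [e [[A0 hA] [B0 hB]]]]]]]]]]].
case=> -[c c0 E1] E2; set F := hyp D in F0 hF E1 *.
rewrite /= -/F !mulr1 in E1.
have ml j : mult (row j p) l = 0%N.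
  apply: mult_nonvanishing; apply: contraNneq (lp j) => z.
  by rewrite -z; apply/eqP/meval_eq => i; rewrite mxE.
have la0 (k : nat) : l ^+ k != 0 by rewrite expf_neq0.
have mla j (k : nat) : mult (row j p) (l ^+ k) = 0%N.
  by rewrite (mult_exp _ _ l0) ml muln0.
have hl1 (k : nat) : l ^+ k \is k.-homog by have := dhomogMn k hl; rewrite mul1n.
have deg : (d + a + e = a' + e)%N.
  apply: (@dhomog_uniq _ _ mdeg (F * l ^+ a * B)).
  - by rewrite mulf_neq0 ?mulf_neq0.
  - by apply: dhomogM hB; apply: dhomogM hF _; apply: hl1.
  by rewrite E1; apply: rpredZ; apply: dhomogM (hl1 _) hA.
congr (_, _); first by move: deg; clear; lia.
apply/rowP => j; rewrite !mxE.
have E3 : (exc D j + b j + mult (row j p) B = b' j + mult (row j p) A)%N.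
  have /ffunP/(_ j) E3 := E2.
  have := etrans (esym (exc_divD_pullback _ p B j)) E3.
  move=> E4; have := etrans E4 (exc_divD_pullback _ p A j).
  rewrite (exc_twist p l a' b') (ml j) muln0 add0n => <-; congr (_ + _)%N.
  apply: esym; apply: etrans (ffunE _ _) _; congr (_ + _)%N.
  by rewrite exc_twist (ml j) muln0.
move: E3.
have := congr1 (mult (row j p)) E1.
rewrite (multZ _ _ c0) (multM _ (mulf_neq0 F0 (la0 a)) B0) (multM _ F0 (la0 a)).
rewrite (multM _ (la0 a') A0) (mla j a) (mla j a') addn0 add0n.
by move: (mult _ A) (mult _ B) (mult _ F) (exc D j) => x y z t; lia.
Qed.

Lemma same_divisor0 D (c : C) : c != 0 -> hyp D = c%:MP -> exc D = [ffun => 0%N] ->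
  same_divisor D (div0 R n s).
Proof. by move=> c0 h1 h2; split=> //; exists c; rewrite // h1 alg_mpolyC. Qed.

(** A prime divisor cannot be split into its strict transform and its exceptional
    part, nor can its exceptional part be split into two. *)
Lemma prime_divisor_cases P : prime_divisor P ->
  (exc P = [ffun => 0%N] /\ exists d, irreducible_form d (hyp P)) \/
  (exists j c, [/\ c != 0, hyp P = c%:MP & exc P = [ffun k => (k == j) : nat]]).
Proof.
move=> [[F0 [d hF]] nP irr].
have e1 : effective (Divisor (1 : {mpoly C[n.+1]}) (exc P)).
  by split; [exact: oner_neq0 | exists 0%N; apply: dhomog1].
have e2 : effective (Divisor (hyp P) [ffun=> 0%N] : divisor R n s).
  by split=> //; exists d.
have sP : same_divisor P (divD (Divisor (hyp P) [ffun=> 0%N]) (Divisor 1 (exc P))).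
  split; first by exists 1; rewrite ?oner_neq0 //= mulr1 scale1r.
  by apply/ffunP => j; rewrite !ffunE.
case: (irr _ _ e2 e1 sP) => [[[c c0 /= Fc] _]|[_ /= exc0]]; last first.
  left; split=> //; exists d; split=> //.
    rewrite lt0n; apply: contra_notN nP => /eqP d0.
    move: hF; rewrite d0 => /dhomog0_const[c Fc].
    apply: (@same_divisor0 _ c) => //.
    by apply: contraNneq F0 => c0; rewrite Fc c0 mpolyC0.
  move=> a b A B hA hB FAB.
  have := F0; rewrite FAB mulf_eq0 negb_or => /andP[A0 B0].
  have eA : effective (Divisor A [ffun=> 0%N] : divisor R n s) by split=> //; exists a.
  have eB : effective (Divisor B [ffun=> 0%N] : divisor R n s) by split=> //; exists b.
  have one c G g : c != 0 -> G \is g.-homog -> G = c *: (1 : {mpoly C[n.+1]}) -> g = 0%N.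
    move=> c0 hG; rewrite alg_mpolyC => Gc.
    by apply: (@const_dhomog _ n.+1 _ _ c0); rewrite -Gc.
  case: (irr _ _ eA eB).
  - split; first by exists 1; rewrite ?oner_neq0 //= scale1r.
    by rewrite exc0; apply/ffunP => j; rewrite !ffunE.
  - by case=> -[c c0 /= Ac] _; left; apply: one c0 hA Ac.
  - by case=> -[c c0 /= Bc] _; right; apply: one c0 hB Bc.
right; rewrite alg_mpolyC in Fc.
case: (pickP (fun j => 0 < exc P j)%N) => [j ej|e0]; last first.
  case: nP; apply: same_divisor0 c0 Fc _; apply/ffunP => j; rewrite ffunE.
  by have := e0 j; case: (exc P j).
exists j, c; split=> //.
pose D1 : divisor R n s := Divisor 1 [ffun k => (k == j) : nat].
pose D2 : divisor R n s := Divisor (hyp P) [ffun k => (exc P k - (k == j))%N].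
have f1 : effective D1 by split; [exact: oner_neq0 | exists 0%N; apply: dhomog1].
have f2 : effective D2 by split=> //; exists d.
have s12 : same_divisor P (divD D1 D2).
  split; first by exists 1; rewrite ?oner_neq0 //= mul1r scale1r.
  apply/ffunP => k; rewrite !ffunE; case: (k =P j) => [->|_].
    by rewrite subnKC.
  by rewrite subn0.
case: (irr _ _ f1 f2 s12) => -[_ /= /ffunP E].
  by have := E j; rewrite !ffunE eqxx.
apply/ffunP => k; have := E k; rewrite !ffunE.
case: (k =P j) => [->|_]; last by rewrite subn0.
by move/eqP; rewrite subn_eq0 => ej1; apply/eqP; rewrite eqn_leq ej1.
Qed.

Lemma DMpairingE (d : int) (m : 'I_s -> int) :
  DMpairing n (d, \row_j m j) (d, \row_j m j) =
  (n%:Z - 1) * d ^+ 2 - \sum_j m j ^+ 2.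
Proof.
rewrite /DMpairing /= -mulrA -expr2; congr (_ - _).
by apply: eq_bigr => j _; rewrite !mxE expr2.
Qed.

Lemma adegE (d : int) (m : 'I_s -> int) : (2 <= n)%N ->
  adeg n (d, \row_j m j) = ((n%:Z + 1) * d + \sum_j m j)%:~R.
Proof.
move=> hn; rewrite /adeg /DMpairing /canonical_class /=.
have n1 : (n%:R - 1 : rat) != 0 by rewrite subr_eq0 pnatr_eq1; lia.
apply: (canLR (mulfK n1)).
have -> : (n%:R - 1 : rat) = (n%:Z - 1)%:~R by rewrite rmorphB.
rewrite -rmorphM; congr (_%:~R).
rewrite [RHS]mulrDl mulr_suml opprK.
under eq_bigr => j _ do rewrite !mxE mulrN.
rewrite sumrN opprK; congr (_ + _); ring.
Qed.

End Divisors.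

Lemma Posz_sum (I : finType) (m : I -> nat) :
  (\sum_j m j)%N%:Z = \sum_j (m j)%:Z.
Proof. exact: (big_morph Posz PoszD). Qed.

Lemma exceptional_multiple_pairing (n s k : nat) (j : 'I_s) (r : int) :
  r = -3 \/ r = -2 ->
  DMpairing n (0%:Z, \row_i (k * (i == j))%N%:Z) (0%:Z, \row_i (k * (i == j))%N%:Z) <> r.
Proof.
move=> hr; rewrite DMpairingE expr0n mulr0 sub0r (bigD1 j) //= eqxx muln1.
rewrite big1 ?addr0 => [|i /negPf ->]; last by rewrite muln0.
by case: k => [|[|k]]; rewrite ?expr0n; case: hr => ->; nia.
Qed.

(** The square of [k] divides [r], which is squarefree. *)
Lemma hypersurface_multiple_numerics (n s d k : nat) (m : 'I_s -> nat) (r : int) :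
  (0 < n)%N -> (0 < k)%N ->
  r = -3 \/ r = -2 ->
  (n%:Z - 1) * (d * k)%N%:Z ^+ 2 - \sum_j (- (k * m j)%N%:Z) ^+ 2 = r ->
  (n%:Z + 1) * (d * k)%N%:Z + \sum_j - (k * m j)%N%:Z = - 2 - r ->
  exists a rho, [/\ (a = 0 /\ rho = 2 \/ a = 1 /\ rho = 3)%N,
    (\sum_j m j + a = n.+1 * d)%N & (\sum_j m j ^ 2 = n.-1 * d ^ 2 + rho)%N].
Proof.
move=> n0 k0 hr.
have -> : \sum_j (- (k * m j)%N%:Z) ^+ 2 = (k%:Z ^+ 2) * (\sum_j m j ^ 2)%N%:Z.
  rewrite Posz_sum mulr_sumr; apply: eq_bigr => j _; rewrite sqrrN; lia.
have -> : \sum_j - (k * m j)%N%:Z = - (k%:Z * (\sum_j m j)%N%:Z).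
  by rewrite sumrN Posz_sum mulr_sumr; congr (- _); apply: eq_bigr => j _; lia.
move: (\sum_j m j)%N (\sum_j m j ^ 2)%N => S Q hQ hS.
have nE : n = n.-1.+1 by lia.
move: (n.-1) nE hQ hS => n' -> hQ hS.
have hk : k%:Z ^+ 2 * (n'%:Z * d%:Z ^+ 2 - Q%:Z) = r by rewrite -hQ; lia.
have k1 : k = 1%N.
  move: hk; move: (_ - _) => X; case: k k0 {hQ hS} => [|[|k]] // _.
  have : 4 <= k.+2%:Z ^+ 2 by rewrite expr2; nia.
  move: (_ ^+ 2) => Y Y4 YX; have Y4' : 0 <= Y - 4 by lia.
  have [X0|X0] : X <= -1 \/ 0 <= X by lia.
    have := mulr_ge0_le0 Y4' (le_trans X0 (isT : (-1 : int) <= 0)).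
    by rewrite mulrBl YX; case: hr => ->; lia.
  have Y0 : 0 <= Y by lia.
  by have := mulr_ge0 Y0 X0; rewrite YX; case: hr => ->.
(* [a = - 2 - r] and [rho = - r]. *)
exists (if r == -2 then 0%N else 1%N), (if r == -2 then 2%N else 3%N).
subst k; split.
- by case: hr => ->; [right|left].
- by move: hS; case: hr => -> /=; lia.
- by move: hk; case: hr => -> /=; lia.
Qed.

Theorem corollary0p9 (R : realType) (n s : nat) (hn : (2 <= n)%N) :
  for_general_points (fun p : 'M[complex R]_(s, n.+1) =>
    forall r : int, r = -3 \/ r = -2 ->
    ~ exists (D : divisor R n s) (delta : pic s),
        [/\ irreducible_divisor D, has_class p D delta,
            DMpairing n delta delta = r &
            adeg n delta = (-2 - r)%:~R]).
Proof.
have n0 : (0 < n)%N := ltnW hn.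
apply: (for_general_points_cremona n0) => p gp r hr.
case=> D [delta [[effD [P [k [primeP k0 [[c c0 hypD] excD]]]]] cl sq deg]].
have [D0 _] := effD.
have excDj j : exc D j = (k * exc P j)%N by rewrite excD; exact: ffunE.
rewrite /= in hypD.
case: (prime_divisor_cases primeP) => [[excP [d irrF]]|[j [b [b0 hypP excP]]]].
  have [F0 hF _ _] := irrF.
  have hD : hyp D \is (d * k).-homog by rewrite hypD; apply/rpredZ/dhomogMn.
  have deltaE := class_of_divisor D0 hD cl.
  pose m j := mult (row j p) (hyp P).
  have dE : delta = ((d * k)%N%:Z, \row_j - (k * m j)%N%:Z).
    rewrite deltaE; congr (_, _); apply/rowP => j; rewrite !mxE.
    rewrite excDj excP hypD (multZ _ _ c0) (mult_exp _ _ F0).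
    by rewrite ffunE muln0 sub0r.
  rewrite dE DMpairingE in sq; rewrite dE (adegE _ _ hn) in deg.
  have [a [rho [ar hsum hsq]]] :=
    hypersurface_multiple_numerics n0 k0 hr sq (intr_inj deg).
  exact: (no_irreducible_form hn gp irrF ar hsum hsq).
have hypDc : hyp D = (c * b ^+ k)%:MP.
  by rewrite hypD hypP -rmorphXn -mul_mpolyC -rmorphM.
have cb0 : c * b ^+ k != 0 by rewrite mulf_neq0 ?expf_neq0.
have hD : hyp D \is 0.-homog.
  by apply/dhomogP => m'; rewrite hypDc msuppC (negPf cb0) inE => /eqP ->; exact: mdeg0.
have deltaE := class_of_divisor D0 hD cl.
have dE : delta = (0%:Z, \row_i (k * (i == j))%N%:Z).
  rewrite deltaE; congr (_, _); apply/rowP => i; rewrite !mxE.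
  by rewrite hypDc (mult_const _ cb0) subr0 excDj excP ffunE.
rewrite dE in sq.
exact: (@exceptional_multiple_pairing n s k j r hr sq).
Qed.
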